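(* Let $n\ge 2$, let $\mathbb{F}$ be a finite field, $\mathbb{K}=\mathbb{F}((t^{-1}))$, $G=\mathrm{SL}_n(\mathbb{K})$, $\Gamma=\mathrm{SL}_n(\mathbb{F}[t])$, and let $A$ be the subgroup of $G$ consisting of diagonal matrices. Suppose $g\in G$. The following are equivalent: (i) There exist a degree $n$ extension $k/\mathbb{F}(t)$ split at $\infty$ and an $\mathbb{F}(t)$-basis $\alpha_1,\dots,\alpha_n$ of $k$ such that $L_g$ is proportional to the form $$L(\mathbf{x})=\prod_{i=1}^n\bigl(\sigma_i(\alpha_1)x_1+\sigma_i(\alpha_2)x_2+\cdots+\sigma_i(\alpha_n)x_n\bigr),$$ where $\sigma_1,\dots,\sigma_n$ are the $n$ distinct $\mathbb{F}(t)$-embeddings of $k$ into $\mathbb{K}$. (ii) The orbit $Ag\Gamma$ is periodic in $G/\Gamma$.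
   Context: With $q=\#\mathbb{F}$, $\mathbb{K}=\mathbb{F}((t^{-1}))$ carries the ultrametric norm $|\cdot|$ for which $|bt^m|=q^m$ for $b\in\mathbb{F}\setminus\{0\}$, $m\in\mathbb{Z}$; $G$ and $A$ carry the induced topology. For $g=(a_{ij})\in G$, $L_g(\mathbf{x})=\prod_{i=1}^n(a_{i1}x_1+\cdots+a_{in}x_n)$. Two forms are proportional if one equals the other multiplied by a nonzero element of $\mathbb{K}$. A degree $n$ extension $k$ of $\mathbb{F}(t)$ is split at $\infty$ if $k=\mathbb{F}(t,\alpha)$ where the minimal polynomial of $\alpha$ over $\mathbb{F}(t)$ has $n$ distinct roots in $\mathbb{K}$; equivalently there are $n$ distinct $\mathbb{F}(t)$-embeddings of $k$ into $\mathbb{K}$. The orbit $Ag\Gamma$ is periodic in $G/\Gamma$ if $\mathrm{Stab}_A(g\Gamma)=A\cap g\Gamma g^{-1}$ is a lattice in $A$, which is equivalent to $Ag\Gamma$ being compact in $G/\Gamma$. *)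

(* Defs.v *)
From HB Require Import structures.
From mathcomp Require Import all_boot all_order all_algebra all_field.
From mathcomp Require Import all_classical all_reals all_analysis.
From mathcomp Require Import zify.

Set Implicit Arguments.
Unset Strict Implicit.
Unset Printing Implicit Defensive.

Import Order.TTheory GRing.Theory Num.Theory.

Local Open Scope classical_set_scope.
Local Open Scope ring_scope.

(* An element sum_(m <= N) c_m t^m of F((t^-1)) is the function m |-> c_m.   *)
Record laurent (F : finFieldType) := Laurent {
  lcoef :> int -> F;
  _ : `[< exists N : int, forall m : int, N < m -> lcoef m = 0 >] }.

HB.instance Definition _ (F : finFieldType) := [isSub of laurent F for @lcoef F].
HB.instance Definition _ (F : finFieldType) := [Choice of laurent F by <:].

Section LaurentRing.
Variable F : finFieldType.
Implicit Types f g h : laurent F.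

Definition lbound (N : int) (f : int -> F) := forall m : int, N < m -> f m = 0.

Lemma lboundP f : exists N, lbound N f.
Proof. by case: f => f /= /asboolP. Qed.

Definition mklaurent (c : int -> F) (N : int) (cN : lbound N c) : laurent F :=
  Laurent (asboolT (ex_intro _ N cN)).

Lemma laurentP f g : f =1 g -> f = g.
Proof. by move=> fg; apply/val_inj/funext. Qed.

Lemma lbound_le M N (c : int -> F) : M <= N -> lbound M c -> lbound N c.
Proof. by move=> MN cM m Nm; apply: cM; apply: le_lt_trans Nm. Qed.

Lemma eq_lbound N (c c' : int -> F) : lbound N c -> lbound N c' ->
  (forall d : nat, c (N - d%:Z) = c' (N - d%:Z)) -> c =1 c'.
Proof.
move=> cN c'N cc' m; have [Nm|mN] := ltP N m; first by rewrite cN ?c'N.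
suff -> : m = N - `|N - m|%N%:Z by [].
by lia.
Qed.

Lemma lzero_subproof : lbound 0 (fun=> 0 : F). Proof. by []. Qed.
Definition lzero := mklaurent lzero_subproof.

Lemma lopp_subproof f : exists N, lbound N (fun m => - f m).
Proof. by have [N fN] := lboundP f; exists N => m /fN ->; rewrite oppr0. Qed.
Definition lopp f : laurent F := Laurent (asboolT (lopp_subproof f)).

Lemma ladd_subproof f g : exists N, lbound N (fun m => f m + g m).
Proof.
have [[M fM] [N gN]] := (lboundP f, lboundP g); exists (Num.max M N) => m.
by rewrite gt_max => /andP[/fM -> /gN ->]; rewrite addr0.
Qed.
Definition ladd f g : laurent F := Laurent (asboolT (ladd_subproof f g)).

Lemma laddA : associative ladd.
Proof. by move=> f g h; apply: laurentP => m /=; rewrite addrA. Qed.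
Lemma laddC : commutative ladd.
Proof. by move=> f g; apply: laurentP => m /=; rewrite addrC. Qed.
Lemma ladd0 : left_id lzero ladd.
Proof. by move=> f; apply: laurentP => m /=; rewrite add0r. Qed.
Lemma laddN : left_inverse lzero lopp ladd.
Proof. by move=> f; apply: laurentP => m /=; rewrite addNr. Qed.

HB.instance Definition _ :=
  GRing.isZmodule.Build (laurent F) laddA laddC ladd0 laddN.

(* The sum has finitely many nonzero terms.                                  *)
Definition lmulc (f g : int -> F) (m : int) : F :=
  \sum_(i \in [set: int]) f i * g (m - i).

Lemma lbound_mulc M N f g : lbound M f -> lbound N g ->
  lbound (M + N) (lmulc f g).
Proof.
move=> fM gN m MNm; apply: fsbig1 => i _.
have [Mi|iM] := ltP M i; first by rewrite fM ?mul0r.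
by rewrite (gN (m - i)) ?mulr0//; lia.
Qed.

Lemma lmul_subproof f g : exists N, lbound N (lmulc f g).
Proof.
have [[M fM] [N gN]] := (lboundP f, lboundP g).
by exists (M + N); exact: lbound_mulc.
Qed.
Definition lmul f g : laurent F := Laurent (asboolT (lmul_subproof f g)).

Definition ltrunc D N (c : int -> F) : {poly F} := \poly_(k < D) c (N - k%:Z).

Lemma coef_mul_congr (p p' q q' : {poly F}) d :
  (forall k, (k <= d)%N -> p`_k = p'`_k) ->
  (forall k, (k <= d)%N -> q`_k = q'`_k) -> (p * q)`_d = (p' * q')`_d.
Proof.
move=> pp' qq'; rewrite !coefM; apply: eq_bigr => -[k kd] _ /=.
by rewrite pp' ?qq' ?leq_subr.
Qed.

Lemma lmulcE M N f g d D : lbound M f -> lbound N g -> (d < D)%N ->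
  lmulc f g (M + N - d%:Z) = (ltrunc D M f * ltrunc D N g)`_d.
Proof.
move=> fM gN dD; rewrite /lmulc.
rewrite (fsbigE [seq M - k%:Z | k <- iota 0 d.+1])//.
- under eq_bigl do rewrite in_setT.
  rewrite big_map -{1}[d.+1]subn0 -/(index_iota 0 d.+1) big_mkord coefM.
  apply: eq_bigr => -[k kd] _ /=; rewrite !coef_poly.
  rewrite (leq_trans kd)// (leq_ltn_trans (leq_subr _ _) dD).
  by congr (_ * g _); lia.
- by rewrite map_inj_uniq ?iota_uniq// => i j; lia.
move=> i _ /negP ir.
have [Mi|iM] := ltP M i; first by rewrite fM ?mul0r.
rewrite (gN (M + N - d%:Z - i)) ?mulr0//.
rewrite ltNge; apply/negP => le; apply: ir; apply/mapP; exists `|M - i|%N.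
  by rewrite mem_iota; lia.
by lia.
Qed.

Lemma lmulE M N f g d D : lbound M f -> lbound N g -> (d < D)%N ->
  lmul f g (M + N - d%:Z) = (ltrunc D M f * ltrunc D N g)`_d.
Proof. exact: lmulcE. Qed.

Lemma lbound_mul M N f g : lbound M f -> lbound N g -> lbound (M + N) (lmul f g).
Proof. exact: lbound_mulc. Qed.

Lemma coef_ltrunc_mul M N f g D k : lbound M f -> lbound N g -> (k < D)%N ->
  (ltrunc D (M + N) (lmul f g))`_k = (ltrunc D M f * ltrunc D N g)`_k.
Proof. by move=> fM gN kD; rewrite coef_poly kD (lmulE _ _ kD). Qed.

Lemma lmulA : associative lmul.
Proof.
move=> f g h; have [M fM] := lboundP f.
have [[N gN] [P hP]] := (lboundP g, lboundP h).
have fgMN := lbound_mul fM gN; have ghNP := lbound_mul gN hP.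
have := lbound_mul fM ghNP; have := lbound_mul fgMN hP; rewrite addrA => b1 b2.
apply/laurentP/(eq_lbound b2 b1) => d.
rewrite (lmulE fgMN hP (ltnSn d)) -addrA (lmulE fM ghNP (ltnSn d)).
rewrite (@coef_mul_congr _ (ltrunc d.+1 M f) _
  (ltrunc d.+1 N g * ltrunc d.+1 P h))//; last first.
  by move=> k kd; rewrite coef_ltrunc_mul.
rewrite mulrA; apply: coef_mul_congr => // k kd.
by rewrite coef_ltrunc_mul.
Qed.

Lemma lmulC : commutative lmul.
Proof.
move=> f g; have [[M fM] [N gN]] := (lboundP f, lboundP g).
have b1 := lbound_mul fM gN; have := lbound_mul gN fM; rewrite addrC => b2.
apply/laurentP/(eq_lbound b1 b2) => d; rewrite (lmulE fM gN (ltnSn d)).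
by rewrite [M + N]addrC (lmulE gN fM (ltnSn d)) mulrC.
Qed.

Lemma lmono_subproof (c : F) (N : int) :
  lbound N (fun m => if m == N then c else 0).
Proof. by move=> m; case: ltgtP. Qed.
Definition lmono (c : F) (N : int) := mklaurent (@lmono_subproof c N).

Lemma lmul1 : left_id (lmono 1 0) lmul.
Proof.
move=> f; have [N fN] := lboundP f.
have b1 : lbound 0 (lmono 1 0) by exact: lmono_subproof.
have := lbound_mul b1 fN; rewrite add0r => b2.
apply/laurentP/(eq_lbound b2 fN) => d.
rewrite -[N in LHS]add0r (lmulE b1 fN (ltnSn d)).
rewrite (@coef_mul_congr _ 1 _ (ltrunc d.+1 N f))//.
  by rewrite mul1r coef_poly ltnSn.
by move=> k kd; rewrite coef_poly ltnS kd coef1 /=; case: k kd.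
Qed.

Lemma lmulD : left_distributive lmul ladd.
Proof.
move=> f g h; have [M0 fM0] := lboundP f.
have [[N0 gN0] [P hP]] := (lboundP g, lboundP h).
pose M := Num.max M0 N0.
have fM : lbound M f by apply: lbound_le fM0; rewrite le_max lexx.
have gM : lbound M g by apply: lbound_le gN0; rewrite le_max lexx orbT.
have fgM : lbound M (ladd f g) by move=> m Mm /=; rewrite fM ?gM ?addr0.
have b1 := lbound_mul fgM hP.
have b2 : lbound (M + P) (ladd (lmul f h) (lmul g h)).
  move=> m Mm /=.
  by rewrite (lbound_mulc fM hP)// (lbound_mulc gM hP)// addr0.
apply/laurentP/(eq_lbound b1 b2) => d; rewrite (lmulE fgM hP (ltnSn d)).
rewrite [RHS]/= (lmulcE fM hP (ltnSn d)) (lmulcE gM hP (ltnSn d)).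
rewrite -coefD -mulrDl; apply: coef_mul_congr => // k kd.
by rewrite coefD !coef_poly ltnS kd.
Qed.

Lemma lone_neq0 : lmono 1 0 != 0.
Proof.
apply/eqP => /(congr1 (fun f : laurent F => f 0)) /= /eqP.
by rewrite oner_eq0.
Qed.

HB.instance Definition _ := GRing.Zmodule_isComNzRing.Build (laurent F)
  lmulA lmulC lmul1 lmulD lone_neq0.

(* The coefficients of the inverse of a power series with constant term u 0. *)
Fixpoint linv_seq (u : nat -> F) (n : nat) : seq F :=
  if n is n'.+1 then
    let s := linv_seq u n' in
    rcons s (if n' is 0%N then (u 0%N)^-1 else
      - (u 0%N)^-1 * \sum_(j < n') u j.+1 * s`_(n' - j.+1))
  else [::].

Lemma size_linv_seq u n : size (linv_seq u n) = n.
Proof. by elim: n => //= n IHn; rewrite size_rcons IHn. Qed.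

Lemma nth_linv_seq u n k : (k < n)%N ->
  (linv_seq u n)`_k = (linv_seq u k.+1)`_k.
Proof.
elim: n => // n IHn; rewrite ltnS leq_eqVlt => /predU1P[->//|kn].
by rewrite [in LHS]/= nth_rcons size_linv_seq kn IHn.
Qed.

Lemma linv_seqE (u : nat -> F) k : u 0%N != 0 ->
  \sum_(j < k.+1) u j * (linv_seq u (k - j).+1)`_(k - j) = (k == 0%N)%:R.
Proof.
move=> u0; rewrite big_ord_recl subn0 /= nth_rcons size_linv_seq ltnn eqxx.
case: k => [|k]; first by rewrite big_ord0 addr0 divff.
rewrite mulNr mulrN mulrA divff// mul1r; apply/eqP.
rewrite addrC subr_eq0; apply/eqP; apply: eq_bigr => j _.
have kj : (k.+1 - j.+1 < k.+1)%N by rewrite ltn_subrL.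
by rewrite (nth_linv_seq _ kj) /bump /= add1n.
Qed.

Lemma ldeg_ex f : f != 0 -> exists N, f N != 0 /\ lbound N f.
Proof.
move=> f0; have [N fN] := lboundP f.
have [d fd] : exists d : nat, f (N - d%:Z) != 0.
  apply: contrapT => /forallNP H; move/eqP: f0; apply; apply: laurentP.
  by apply: (eq_lbound fN) => // d; apply/eqP/negPn/negP/H.
pose P d := f (N - d%:Z) != 0.
have exP : exists d, P d by exists d.
exists (N - (ex_minn exP)%:Z); case: ex_minnP => e Pe minP; split=> // m em.
have [Nm|mN] := ltP N m; first exact: fN.
apply/eqP/negPn/negP => fm.
have := minP `|N - m|%N; rewrite /P.
have -> : N - `|N - m|%N%:Z = m by lia.
by move=> /(_ fm); lia.
Qed.

Lemma linv_ex f : f != 0 -> exists g, g * f = 1.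
Proof.
move=> /ldeg_ex[N [fN0 fN]]; pose u k := f (N - k%:Z).
have u0 : u 0%N != 0 by rewrite /u subr0.
pose c m := if m <= - N then (linv_seq u (`|- N - m|%N).+1)`_(`|- N - m|%N) else 0.
have cN : lbound (- N) c by move=> m Nm; rewrite /c leNgt Nm.
exists (mklaurent cN); rewrite mulrC.
have gN : lbound (- N) (mklaurent cN) by [].
have := lbound_mul fN gN; rewrite subrr => b1.
have b2 : lbound 0 (lmono 1 0) by exact: lmono_subproof.
apply/laurentP/(eq_lbound b1 b2) => d.
rewrite -[X in lmul _ _ (X - _)](subrr N) (lmulE fN gN (ltnSn d)).
transitivity ((d == 0%N)%:R : F); last by case: d.
rewrite -(linv_seqE d u0) coefM; apply: eq_bigr => -[k kd] _ /=.
rewrite !coef_poly kd ltnS leq_subr /= /c.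
have -> : - N - (d - k)%N%:Z <= - N by lia.
by congr (_ * _`_ _); [congr (linv_seq u _.+1)|]; lia.
Qed.

Definition linv f : laurent F := xget 0 [set g | g * f = 1].

Lemma lmulV f : f != 0 -> linv f * f = 1.
Proof. by move=> /linv_ex fg; exact: (xgetPex 0 fg). Qed.

Lemma linv0 : linv 0 = 0.
Proof.
rewrite /linv; case: xgetP => // g _ /= /esym/eqP.
by rewrite mulr0 oner_eq0.
Qed.

HB.instance Definition _ := GRing.ComNzRing_isField.Build (laurent F) lmulV linv0.

Lemma poly_laurent_subproof (p : {poly F}) :
  lbound (size p)%:Z (fun m => if m is Posz k then p`_k else 0).
Proof. by case=> // k; rewrite ltz_nat => pk; rewrite nth_default// ltnW. Qed.
Definition poly_laurent (p : {poly F}) := mklaurent (@poly_laurent_subproof p).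

Lemma poly_laurent_zmod_morphism : zmod_morphism poly_laurent.
Proof.
by move=> p q; apply: laurentP => -[k|k] /=; rewrite ?coefB// subr0.
Qed.
HB.instance Definition _ := GRing.isZmodMorphism.Build
  {poly F} (laurent F) poly_laurent poly_laurent_zmod_morphism.

Lemma poly_laurent_monoid_morphism : monoid_morphism poly_laurent.
Proof.
split=> [|p q]; apply: laurentP => -[k|k] //=; first by rewrite coef1; case: k.
  rewrite /lmulc (fsbigE [seq k%:Z | k <- iota 0 k.+1])//.
  - under eq_bigl do rewrite in_setT.
    rewrite big_map -{1}[k.+1]subn0 -/(index_iota 0 k.+1) big_mkord coefM.
    apply: eq_bigr => -[j jk] _ /=.
    by have -> : k%:Z - j%:Z = (k - j)%N%:Z by lia.
  - by rewrite map_inj_uniq ?iota_uniq// => i j [].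
  case=> [j|j] _ /negP jk; last by rewrite mul0r.
  case E : (k%:Z - j%:Z) => [l|l]; last by rewrite mulr0.
  by case: jk; apply/mapP; exists j => //; rewrite mem_iota; lia.
symmetry; apply: fsbig1 => -[j|j] _; last by rewrite mul0r.
by case E : (Negz k - j%:Z) => [l|l]; [lia|rewrite mulr0].
Qed.
HB.instance Definition _ := GRing.isMonoidMorphism.Build
  {poly F} (laurent F) poly_laurent poly_laurent_monoid_morphism.

Lemma poly_laurent_inj : injective poly_laurent.
Proof.
move=> p q pq; apply/polyP => k.
exact: (congr1 (fun f : laurent F => f k%:Z) pq).
Qed.

End LaurentRing.

Section FractionLaurent.
Variable F : finFieldType.
Local Notation "p %:F" := (@FracField.tofrac _ p).

Definition fraction_laurent (x : {fraction {poly F}}) : laurent F :=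
  poly_laurent (frac (repr x)).1 / poly_laurent (frac (repr x)).2.

Lemma poly_laurent_eq0 (p : {poly F}) : (poly_laurent p == 0) = (p == 0).
Proof. by rewrite raddf_eq0//; exact: poly_laurent_inj. Qed.

Lemma fraction_numden (x : {fraction {poly F}}) :
  x = (frac (repr x)).1 %:F / (frac (repr x)).2 %:F.
Proof.
have d0 : (frac (repr x)).2 %:F != 0 by rewrite tofrac_eq0 denom_ratioP.
apply: (mulIf d0); rewrite divfK//.
rewrite -{1}[x]reprK; unlock FracField.tofrac; rewrite -[LHS]FracField.pi_mul.
apply/eqmodP; rewrite /= FracField.equivfE /FracField.mulf.
rewrite !numden_Ratio ?mulf_neq0 ?denom_ratioP ?oner_eq0//.
by rewrite !mulr1 mulrC.
Qed.

Lemma fraction_laurentE (p q : {poly F}) : q != 0 ->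
  fraction_laurent (p%:F / q%:F) = poly_laurent p / poly_laurent q.
Proof.
move=> q0; rewrite /fraction_laurent.
have := fraction_numden (p%:F / q%:F).
set y := repr _; have d0 : (frac y).2 != 0 by exact: denom_ratioP.
move/eqP; rewrite eqr_div ?tofrac_eq0// -!rmorphM/= tofrac_eq => /eqP pd.
apply/eqP; rewrite eqr_div ?poly_laurent_eq0//.
by rewrite -!rmorphM/= pd.
Qed.

Lemma fractionP (x : {fraction {poly F}}) :
  exists p q : {poly F}, q != 0 /\ x = p%:F / q%:F.
Proof.
exists (frac (repr x)).1, (frac (repr x)).2; split; first exact: denom_ratioP.
exact: fraction_numden.
Qed.

Lemma fraction_laurent_zmod_morphism : zmod_morphism fraction_laurent.
Proof.
move=> x y; have [[p [q [q0 ->]]] [r [s [s0 ->]]]] := (fractionP x, fractionP y).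
rewrite -mulNr addf_div ?tofrac_eq0// -rmorphN -!rmorphM -rmorphD.
rewrite !fraction_laurentE ?mulf_neq0// -mulNr addf_div ?poly_laurent_eq0//.
by rewrite -rmorphN -!rmorphM -rmorphD.
Qed.
HB.instance Definition _ := GRing.isZmodMorphism.Build
  {fraction {poly F}} (laurent F) fraction_laurent
  fraction_laurent_zmod_morphism.

Lemma fraction_laurent_monoid_morphism : monoid_morphism fraction_laurent.
Proof.
split=> [|x y].
  have -> : 1 = 1%:F / 1%:F :> {fraction {poly F}} by rewrite rmorph1 divr1.
  by rewrite fraction_laurentE ?oner_eq0// rmorph1 divr1.
have [[p [q [q0 ->]]] [r [s [s0 ->]]]] := (fractionP x, fractionP y).
rewrite mulf_div -!rmorphM !fraction_laurentE ?mulf_neq0// mulf_div.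
by rewrite -!rmorphM.
Qed.
HB.instance Definition _ := GRing.isMonoidMorphism.Build
  {fraction {poly F}} (laurent F) fraction_laurent
  fraction_laurent_monoid_morphism.

Lemma fraction_laurent_tofrac (p : {poly F}) :
  fraction_laurent p%:F = poly_laurent p.
Proof.
have -> : p%:F = p%:F / 1%:F by rewrite rmorph1 divr1.
by rewrite fraction_laurentE ?oner_eq0// rmorph1 divr1.
Qed.

End FractionLaurent.

Section LaurentNorm.
Variable F : finFieldType.
Implicit Types f g h : laurent F.

Definition ldeg f : int := xget 0 [set N : int | f N != 0 /\ lbound N f].

(* The values |f| = q^(ldeg f), q = #F, are rational.                        *)
Definition lnorm f : rat := if f == 0 then 0 else #|F|%:R ^ ldeg f.

Let q1 : 1 < #|F|%:R :> rat.
Proof. by rewrite ltr1n finNzRing_gt1. Qed.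

Let q0 : 0 < #|F|%:R :> rat. Proof. exact: lt_trans q1. Qed.

Lemma ldegP f : f != 0 -> f (ldeg f) != 0 /\ lbound (ldeg f) f.
Proof. by move=> /ldeg_ex fN; exact: (xgetPex 0 fN). Qed.

Lemma ldegE f N : f N != 0 -> lbound N f -> ldeg f = N.
Proof.
move=> fN0 fN; have f0 : f != 0.
  by apply: contraNneq fN0 => ->.
have [fd0 fd] := ldegP f0.
have [dN|Nd|//] := ltgtP (ldeg f) N.
  by rewrite (fd _ dN) eqxx in fN0.
by rewrite (fN _ Nd) eqxx in fd0.
Qed.

Lemma lnorm_mono (b : F) (m : int) : b != 0 ->
  lnorm (lmono b m) = #|F|%:R ^ m.
Proof.
move=> b0; have bm : lmono b m m != 0 by rewrite /= eqxx.
rewrite /lnorm (ldegE bm (@lmono_subproof _ b m)) ifF//; apply/eqP => bm0.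
by rewrite bm0 eqxx in bm.
Qed.

Lemma lnorm_ge0 f : 0 <= lnorm f.
Proof. by rewrite /lnorm; case: eqP => // _; rewrite exprz_ge0// ltW. Qed.

Lemma lnorm0_eq0 f : lnorm f = 0 -> f = 0.
Proof.
by rewrite /lnorm; case: eqP => // _ /eqP; rewrite expfz_eq0 (gt_eqF q0) andbF.
Qed.

Lemma lnormN f : lnorm (- f) = lnorm f.
Proof.
rewrite /lnorm oppr_eq0; have [//|f0] := eqVneq f 0.
have [fd0 fd] := ldegP f0; congr (_ ^ _); apply: ldegE => [|m md].
  by rewrite /= oppr_eq0.
by rewrite /= fd ?oppr0.
Qed.

Lemma lnorm_le f N : (lnorm f <= #|F|%:R ^ N) <-> lbound N f.
Proof.
rewrite /lnorm; have [->|f0] := eqVneq f 0.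
  by split=> // _; rewrite exprz_ge0// ltW.
have [fd0 fd] := ldegP f0; rewrite ler_eXz2l//; split=> [dN|fN].
  exact: lbound_le fd.
by rewrite leNgt; apply/negP => Nd; rewrite (fN _ Nd) eqxx in fd0.
Qed.

Lemma lnorm_ultra f g : lnorm (f + g) <= Num.max (lnorm f) (lnorm g).
Proof.
have [->|f0] := eqVneq f 0; first by rewrite add0r le_max lexx orbT.
have [->|g0] := eqVneq g 0; first by rewrite addr0 le_max lexx.
wlog fg : f g f0 g0 / lnorm f <= lnorm g.
  move=> H; have [fg|/ltW gf] := leP (lnorm f) (lnorm g).
    by have := H _ _ f0 g0 fg; rewrite max_r.
  by have := H _ _ g0 f0 gf; rewrite addrC max_r.
rewrite max_r//; have gE : lnorm g = #|F|%:R ^ ldeg g.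
  by rewrite /lnorm (negPf g0).
move: fg; rewrite gE => /lnorm_le fd; apply/lnorm_le => m md /=.
by rewrite fd// (ldegP g0).2// addr0.
Qed.

Lemma lnorm0 : lnorm 0 = 0. Proof. by rewrite /lnorm eqxx. Qed.

Definition ldist f g := lnorm (f - g).

Lemma ldistxx f : ldist f f = 0. Proof. by rewrite /ldist subrr lnorm0. Qed.

Lemma ldist_eq0 f g : ldist f g = 0 -> f = g.
Proof. by move/lnorm0_eq0/eqP; rewrite subr_eq0 => /eqP. Qed.

Lemma ldist_sym f g : ldist f g = ldist g f.
Proof. by rewrite /ldist -lnormN opprB. Qed.

Lemma ldist_triangle g f h : ldist f h <= ldist f g + ldist g h.
Proof.
rewrite /ldist -[f - h](subrKA g) (le_trans (lnorm_ultra _ _))// ge_max.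
by rewrite lerDl lerDr !lnorm_ge0.
Qed.

HB.instance Definition _ := isMetric.Build rat (laurent F)
  ldistxx ldist_eq0 ldist_sym ldist_triangle.

End LaurentNorm.

(* Continuity of the operations is not part of the structure: the definition *)
(* of a lattice does not need it.                                            *)
#[short(type="topologyGroupType")]
HB.structure Definition TopologyGroup := {H of Topological H & Group H}.

Record SL (R : comUnitRingType) (n : nat) := MkSL {
  SL_mx :> 'M[R]_n;
  _ : \det SL_mx == 1 }.

HB.instance Definition _ (R : comUnitRingType) (n : nat) :=
  [isSub of SL R n for @SL_mx R n].
HB.instance Definition _ (R : comUnitRingType) (n : nat) :=
  [Choice of SL R n by <:].

Section SLGroup.
Variables (R : comUnitRingType) (n : nat).
Implicit Types g h : SL R n.

Lemma det_SL g : \det g = 1. Proof. by case: g => g /= /eqP. Qed.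

Lemma SL_unit g : SL_mx g \in unitmx. Proof. by rewrite unitmxE det_SL unitr1. Qed.

Lemma SL1_subproof : \det (1%:M : 'M[R]_n) == 1. Proof. by rewrite det1. Qed.
Lemma SLM_subproof g h : \det (g *m h) == 1.
Proof. by rewrite det_mulmx !det_SL mulr1. Qed.
Lemma SLV_subproof g : \det (invmx g) == 1.
Proof. by rewrite det_inv det_SL invr1. Qed.

Definition SL_one := MkSL SL1_subproof.
Definition SL_mul g h := MkSL (SLM_subproof g h).
Definition SL_inv g := MkSL (SLV_subproof g).

Lemma SL_mulA : associative SL_mul.
Proof. by move=> f g h; apply/val_inj/mulmxA. Qed.
Lemma SL_mul1 : left_id SL_one SL_mul.
Proof. by move=> g; apply/val_inj/mul1mx. Qed.
Lemma SL_mulg1 : right_id SL_one SL_mul.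
Proof. by move=> g; apply/val_inj/mulmx1. Qed.
Lemma SL_mulV : left_inverse SL_one SL_inv SL_mul.
Proof. by move=> g; apply/val_inj/mulVmx/SL_unit. Qed.
Lemma SL_mulgV : right_inverse SL_one SL_inv SL_mul.
Proof. by move=> g; apply/val_inj/mulmxV/SL_unit. Qed.

HB.instance Definition _ := isGroup.Build (SL R n)
  SL_mulA SL_mul1 SL_mulg1 SL_mulV SL_mulgV.

Definition SL_diag : {pred SL R n} := fun g => is_diag_mx (SL_mx g).

Lemma SL_diag_closed : group_closed SL_diag.
Proof.
split=> [|g h /is_diag_mxP gd /is_diag_mxP hd].
  apply/is_diag_mxP => i j ij; rewrite !mxE.
  by rewrite (negPf ij : (i == j) = false).
have hu i : h i i \is a GRing.unit.
  have : \det h \is a GRing.unit by rewrite det_SL unitr1.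
  rewrite (_ : \det h = \prod_i h i i); last first.
    by apply: det_trig; apply/is_trig_mxP => k l kl; apply: hd; rewrite ltn_eqF.
  by rewrite (bigD1 i)//= unitrM => /andP[].
have hVd (i j : 'I_n) : i != j :> nat -> invmx h i j = 0.
  move=> ij; have := mulmxV (SL_unit h) => /matrixP/(_ i j).
  rewrite !mxE (negPf ij : (i == j) = false) (bigD1 i)//= big1 => [|k ki].
    by rewrite addr0 => /(congr1 ( *%R (h i i)^-1)); rewrite mulKr// mulr0.
  by rewrite hd ?mul0r// eq_sym.
apply/is_diag_mxP => i j ij; rewrite mxE big1// => k _.
have [ik|ik] := eqVneq i k; last by rewrite gd ?mul0r.
by rewrite -ik hVd ?mulr0.
Qed.

End SLGroup.

Record diagSL (R : comUnitRingType) (n : nat) := MkDiagSL {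
  diagSL_SL :> SL R n;
  _ : SL_diag diagSL_SL }.

HB.instance Definition _ (R : comUnitRingType) (n : nat) :=
  [isSub of diagSL R n for @diagSL_SL R n].
HB.instance Definition _ (R : comUnitRingType) (n : nat) :=
  [Choice of diagSL R n by <:].
HB.instance Definition _ (R : comUnitRingType) (n : nat) :=
  SubChoice_isSubGroup.Build (SL R n) (@SL_diag R n) (diagSL R n)
    (@SL_diag_closed R n).

HB.instance Definition _ (F : finFieldType) (n : nat) :=
  Topological.copy (SL (laurent F) n) (initial_topology (@SL_mx (laurent F) n)).
HB.instance Definition _ (F : finFieldType) (n : nat) :=
  Topological.copy (diagSL (laurent F) n)
    (initial_topology (@diagSL_SL (laurent F) n)).

Definition left_coset (H : groupType) (Lam : set H) (h : H) : set H :=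
  [set (h * l)%g | l in Lam].

Record coset_space (H : groupType) (Lam : set H) := CosetSpace {
  coset_set :> set H;
  _ : `[< range (left_coset Lam) coset_set >] }.

HB.instance Definition _ (H : groupType) (Lam : set H) :=
  [isSub of coset_space Lam for @coset_set H Lam].
HB.instance Definition _ (H : groupType) (Lam : set H) :=
  [Choice of coset_space Lam by <:].

Section CosetSpace.
Variables (H : groupType) (Lam : set H).
Implicit Type C : coset_space Lam.

Definition coset_proj (h : H) : coset_space Lam :=
  CosetSpace (asboolT (imageT (left_coset Lam) h)).

HB.instance Definition _ := isPointed.Build (coset_space Lam) (coset_proj 1%g).

Lemma coset_act_subproof (h : H) C :
  range (left_coset Lam) [set (h * c)%g | c in (C : set H)].
Proof.
case: C => C /= /asboolP[x _ <-]; exists (h * x)%g => //.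
by rewrite /left_coset image_comp; apply: eq_imagel => l _ /=; rewrite mulgA.
Qed.
Definition coset_act (h : H) C : coset_space Lam :=
  CosetSpace (asboolT (coset_act_subproof h C)).

End CosetSpace.

Section CosetTopology.
Variables (H : topologyGroupType) (Lam : set H).

Definition coset_open (U : set (coset_space Lam)) :=
  open (coset_proj Lam @^-1` U).

Lemma coset_openT : coset_open setT.
Proof. by rewrite /coset_open preimage_setT; exact: openT. Qed.

Lemma coset_openI : setI_closed coset_open.
Proof. by move=> U V oU oV; rewrite /coset_open preimage_setI; exact: openI. Qed.

Lemma coset_open_bigcup (I : Type) (U : I -> set (coset_space Lam)) :
  (forall i, coset_open (U i)) -> coset_open (\bigcup_i U i).
Proof.
by move=> oU; rewrite /coset_open preimage_bigcup; apply: bigcup_open => i _;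
   exact: oU.
Qed.

HB.instance Definition _ := isOpenTopological.Build (coset_space Lam)
  coset_openT coset_openI coset_open_bigcup.

Definition discrete_subgroup :=
  group_closed (mem Lam) /\ Lam `<=` isolated Lam.

(* A discrete subgroup such that H / Lam carries a nonzero finite H-invariant *)
(* Borel measure.                                                            *)
Definition is_lattice (R : realType) : Prop :=
  discrete_subgroup /\
  exists mu : {measure set (g_sigma_algebraType (@open (coset_space Lam)))
               -> \bar R},
    (0 < mu setT < +oo)%E /\
    forall (h : H) (B : set (coset_space Lam)),
      (@open (coset_space Lam)).-sigma.-measurable B ->
      mu (coset_act h @` B) = mu B.

End CosetTopology.

Section PeriodicOrbit.
Variables (F : finFieldType) (n : nat).
Local Notation K := (laurent F).

Definition SL_poly : set (SL K n) :=
  [set g | exists P : SL {poly F} n, SL_mx g = map_mx (@poly_laurent F) P].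

Definition diag_stab (x : coset_space SL_poly) : set (diagSL K n) :=
  [set a | coset_act a x = x].

Definition periodic_orbit (R : realType) (x : coset_space SL_poly) :=
  is_lattice (diag_stab x) R.

End PeriodicOrbit.

Section Forms.
Variables (K : fieldType) (n : nat).

(* Forms are taken as functions on K^n; the field used, F((t^-1)), is        *)
(* infinite, so that no two distinct polynomials are identified.             *)
Definition linear_form_prod (M : 'M[K]_n) (x : 'cV[K]_n) : K :=
  \prod_(i < n) \sum_(j < n) M i j * x j 0.

Definition proportional (f h : 'cV[K]_n -> K) :=
  exists2 c : K, c != 0 & forall x, f x = c * h x.

End Forms.

Section SplitExtension.
Variables (F : finFieldType) (k : fieldExtType {fraction {poly F}}).
Local Notation K := (laurent F).

Definition split_at_infty (n : nat) :=
  exists a : k, <<1; a>>%VS = fullv /\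
  exists (p : {poly {fraction {poly F}}}) (s : seq K),
    [/\ map_poly (in_alg k) p = minPoly 1 a, size s = n, uniq s &
        all (root (map_poly (@fraction_laurent F) p)) s].

Definition embedding (s : {rmorphism k -> K}) :=
  forall r : {fraction {poly F}}, s r%:A = fraction_laurent r.

Definition all_embeddings (n : nat) (s : 'I_n -> {rmorphism k -> K}) :=
  [/\ forall i, embedding (s i),
      forall i j, s i =1 s j -> i = j &
      forall s' : {rmorphism k -> K}, embedding s' -> exists i, s' =1 s i].

End SplitExtension.

(* Main.v *)
From HB Require Import structures.
Require Import Defs.
From mathcomp Require Import all_boot all_order all_algebra all_field.
From mathcomp Require Import all_classical all_reals all_analysis.
From mathcomp Require Import zify.

(** Write K for F((t^-1)), A for the diagonal subgroup of SL_n(K), Lam for the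
    stabilizer of g Gamma in A and A_0 for the elements of A all of whose
    entries have norm 1. Modulo A_0 an element of A is known by the degrees of
    its entries, so that A / A_0 is the group of integer vectors with sum 0,
    and both implications turn on the degree vectors attained on Lam.

    From the field to the periodic orbit. A product of linear forms vanishes
    on a union of hyperplanes, and over an infinite field that union determines
    the hyperplanes; so, up to the order of the embeddings, the rows of g are
    multiples of the rows of (sigma_i(alpha_j)) (proportional_rows). For a
    common denominator f, multiplication by f alpha_j is therefore given by a
    polynomial matrix, and g diagonalizes all these matrices at once, with the
    conjugates of f alpha_j as eigenvalues. Now Dirichlet's argument applies.
    Counting coefficients yields, for each degree vector d, a nonzero x in the
    F[t]-span of the f alpha_j with deg sigma_i(x) <= d_i + C, where C does not
    depend on d (minkowski). The norm h of x is a nonzero polynomial, of degree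
    at most n C; hence the numbers d_i + C - deg sigma_i(x), the polynomial h
    and the matrix of x modulo h take finitely many values, and when two such x
    agree on them their quotient is an integral unit of norm 1, that is, an
    element of Lam (polycomb_quotient, enough_units). So Lam A_0 has finite
    index in A. The congruence subgroups U_m of A_0 then make A / Lam an
    inverse limit of finite groups, and the normalized counting measures on
    these groups fit together into an invariant Borel measure of mass 1
    (filtration_invariant_measure). Lam is discrete because a polynomial matrix
    close to the identity is the identity (diag_stab_discrete).

    From the periodic orbit to the field. The A_0-orbits in A / Lam are open
    and pairwise translates of each other, and there are countably many of
    them, so they share one positive measure. As the total mass is finite, the
    powers of any element of A meet the same A_0-orbit twice: a multiple of
    every degree vector is attained on Lam (periodic_recurrence). Take a degree
    vector with distinct entries and no proper nonempty subset of entries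
    summing to 0 (generic_degrees). It yields a matrix P in SL_n(F[t]) with
    distinct eigenvalues a_i in K. The characteristic polynomial of P is
    irreducible over F(t): the constant term of a monic factor is, up to sign,
    a product of eigenvalues, so it is a unit of F[t] because F[t] is
    integrally closed, so it has degree 0, and by the choice of the degrees the
    factor is trivial (p_irreducible). Let k be generated by a root z. A left
    eigenvector of P over k for z specializes, under the embedding sending z to
    a_i, to a left eigenvector for a_i, hence to a multiple of row i of g; its
    entries are the basis (unit_to_split_field). *)

Set Implicit Arguments.
Unset Strict Implicit.
Unset Printing Implicit Defensive.

Import Order.TTheory GRing.Theory Num.Theory.

Local Open Scope classical_set_scope.
Local Open Scope ring_scope.

(* Bounds on degrees, as opposed to lower bounds of sets. *)
Local Notation lbound := Defs.lbound.

(** * Degrees of Laurent series *)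

Section LaurentDegree.
Variable F : finFieldType.
Implicit Types f g h : laurent F.

Lemma lboundM M N f g : lbound M f -> lbound N g -> lbound (M + N) (f * g).
Proof. exact: lbound_mul. Qed.

Lemma lboundD N f g : lbound N f -> lbound N g -> lbound N (f + g).
Proof. by move=> fN gN m Nm /=; rewrite fN// gN// addr0. Qed.

Lemma lboundB N f g : lbound N f -> lbound N g -> lbound N (f - g).
Proof. by move=> fN gN m Nm /=; rewrite fN// gN// subrr. Qed.

Lemma lboundN N f : lbound N f -> lbound N (- f).
Proof. by move=> fN m Nm /=; rewrite fN// oppr0. Qed.

Lemma lbound_sum (I : Type) (r : seq I) (P : pred I) (E : I -> laurent F) N :
  (forall i, P i -> lbound N (E i)) -> lbound N (\sum_(i <- r | P i) E i).
Proof. by move=> EN; apply: (big_ind (fun f : laurent F => lbound N f)) => // f g; exact: lboundD. Qed.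

Lemma ldeg_lbound f : lbound (ldeg f) f.
Proof. by have [->//|/ldegP[]] := eqVneq f 0. Qed.

Lemma ldeg_neq0 f : f != 0 -> f (ldeg f) != 0.
Proof. by move/ldegP => []. Qed.

Lemma ldeg_le f N : f != 0 -> lbound N f -> ldeg f <= N.
Proof.
by move=> f0 fN; rewrite leNgt; apply/negP => /fN /eqP; exact/negP/ldeg_neq0.
Qed.

Lemma coef_mul_top M N f g : lbound M f -> lbound N g ->
  (f * g) (M + N) = f M * g N.
Proof.
move=> fM gN; rewrite -[M + N]subr0 (lmulE fM gN (ltn0Sn 0)).
by rewrite coefM big_ord1 !coef_poly /= !subr0.
Qed.

Lemma ldegM f g : f != 0 -> g != 0 -> ldeg (f * g) = ldeg f + ldeg g.
Proof.
move=> f0 g0; apply: ldegE; last by apply: lboundM; exact: ldeg_lbound.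
rewrite coef_mul_top; [|exact: ldeg_lbound..].
by rewrite mulf_neq0// ldeg_neq0.
Qed.

Lemma ldeg_mono (b : F) m : b != 0 -> ldeg (lmono b m) = m.
Proof. by move=> b0; apply: ldegE => /=; [rewrite eqxx | exact: lmono_subproof]. Qed.

Lemma lmono_neq0 (b : F) m : b != 0 -> lmono b m != 0.
Proof.
move=> b0; apply: contraNneq b0 => /(congr1 (fun f : laurent F => f m)) /=.
by rewrite eqxx => ->.
Qed.

Lemma lbound_mono (b : F) m : lbound m (lmono b m).
Proof. exact: lmono_subproof. Qed.

Lemma lmonoM (b c : F) i j : lmono b i * lmono c j = lmono (b * c) (i + j).
Proof.
have bi := @lbound_mono b i; have cj := @lbound_mono c j.
have bcij := lboundM bi cj.
apply/laurentP/(eq_lbound bcij); first exact: lbound_mono.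
have E x e k : (ltrunc k.+1 e (lmono x e)) = x%:P.
  apply/polyP => d; rewrite coef_poly coefC /=.
  case: d => [|d] /=; first by rewrite subr0 eqxx.
  by case: ifP => // _; rewrite ifF//; apply/negbTE; lia.
move=> d; rewrite (lmulE bi cj (ltnSn d)) !E -polyCM coefC /=.
case: d => [|d] /=; first by rewrite subr0 eqxx.
by rewrite ifF//; apply/negbTE; lia.
Qed.

Lemma ldeg1 : @ldeg F 1 = 0.
Proof. by apply: ldeg_mono; exact: oner_neq0. Qed.

Lemma ldegV f : f != 0 -> ldeg f^-1 = - ldeg f.
Proof.
move=> f0; apply/eqP; rewrite -addr_eq0; apply/eqP.
by rewrite -ldegM ?invr_eq0// (mulVf f0); exact: ldeg1.
Qed.

Lemma ldegN f : ldeg (- f) = ldeg f.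
Proof.
have [->|f0] := eqVneq f 0; first by rewrite oppr0.
by apply: ldegE => [|m fm] /=; rewrite ?oppr_eq0 ?ldeg_neq0// ldeg_lbound ?oppr0.
Qed.

Lemma ldeg_prod (I : Type) (r : seq I) (P : pred I) (E : I -> laurent F) :
  (forall i, P i -> E i != 0) ->
  ldeg (\prod_(i <- r | P i) E i) = \sum_(i <- r | P i) ldeg (E i).
Proof.
move=> E0.
pose Q f (z : int) := f != 0 /\ ldeg f = z.
suff [] : Q (\prod_(i <- r | P i) E i) (\sum_(i <- r | P i) ldeg (E i)) by [].
apply: (big_ind2 Q) => [|f1 z1 f2 z2 [f10 <-] [f20 <-]|i Pi].
- by split; [exact: oner_neq0 | exact: ldeg1].
- by split; [exact: mulf_neq0 | exact: ldegM].
- by split; [exact: E0|].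
Qed.

Lemma lbound_poly (p : {poly F}) d : (size p <= d.+1)%N ->
  lbound d%:Z (poly_laurent p).
Proof. by move=> pd [m|m] //=; rewrite ltz_nat => dm; rewrite nth_default// (leq_trans pd). Qed.

Lemma ldeg_poly (p : {poly F}) : p != 0 -> ldeg (poly_laurent p) = (size p).-1%:Z.
Proof.
move=> p0; apply: ldegE => /=; first by rewrite -lead_coefE lead_coef_eq0.
by apply: lbound_poly; exact: leqSpred.
Qed.

Lemma poly_laurent_lt0 (p : {poly F}) : lbound (-1) (poly_laurent p) -> p = 0.
Proof.
move=> pN; apply/polyP => k; rewrite coef0.
by have /= -> // := pN k%:Z; lia.
Qed.

(** Completeness of K: each coefficient is eventually constant along the
    sequence, and the limit reads it off there. *)
Lemma laurent_cauchy_lim (x : nat -> laurent F) (N : nat -> int) :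
  (forall m, lbound (N m) (x m.+1 - x m)) ->
  (forall m, N m.+1 <= N m) -> (forall z : int, exists m, N m < z) ->
  exists y, forall m, lbound (N m) (y - x m).
Proof.
move=> xN Nle Nlim.
have Nmono m j : N (m + j)%N <= N m.
  by elim: j => [|j IHj]; rewrite ?addn0// addnS (le_trans (Nle _)).
have xm m j : lbound (N m) (x (m + j)%N - x m).
  elim: j => [|j IHj]; first by rewrite addn0 subrr.
  rewrite addnS -[x _ - _](subrKA (x (m + j)%N)); apply: lboundD => //.
  exact: lbound_le (Nmono m j) (xN _).
have [mu muP] := choice Nlim.
have xE m z : N m < z -> x m z = x (mu z) z.
  move=> mz; have key a b : (a <= b)%N -> N a < z -> x a z = x b z.
    move=> ab az; have := xm a (b - a)%N z az.
    by rewrite subnKC//= => /eqP; rewrite subr_eq0 => /eqP.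
  by have [ab|/ltnW ab] := leqP m (mu z); [exact: key|rewrite (key (mu z) m)].
have [N0 x0N] := lboundP (x 0%N).
have yN : lbound (Num.max (N 0%N) N0) (fun z => x (mu z) z).
  move=> z; rewrite gt_max => /andP[z0 zN0].
  by rewrite -(xE 0%N)// x0N.
by exists (mklaurent yN) => m z mz /=; rewrite -(xE _ _ mz) subrr.
Qed.

End LaurentDegree.

Section OneUnits.
Variable F : finFieldType.
Implicit Types f g : laurent F.

Lemma near1_mul z f g : z <= 0 -> lbound z (f - 1) -> lbound z (g - 1) ->
  lbound z (f * g - 1).
Proof.
move=> z0 f1 g1; have -> : f * g - 1 = (f - 1) * (g - 1) + ((f - 1) + (g - 1)).
  rewrite mulrBl mul1r mulrBr mulr1; rewrite addrACA addrA.
  by rewrite subrK addrA subrK.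
apply: lboundD; last exact: lboundD.
by apply: lbound_le (lboundM f1 g1); lia.
Qed.

(** A series close to 1 shares its leading coefficient with 1. *)
Lemma near1_ldeg z f : z < 0 -> lbound z (f - 1) -> ldeg f = 0.
Proof.
move=> z0 f1; have fE : f = 1 + (f - 1) by rewrite addrC subrK.
apply: ldegE.
  by have /= /eqP := f1 _ z0; rewrite subr_eq0 => /eqP ->; exact: oner_neq0.
rewrite fE; apply: lboundD; first exact: lbound_mono.
by apply: lbound_le f1; exact: ltW.
Qed.

Lemma lbound_ratio z f g : g != 0 -> lbound (ldeg g + z) (f - g) ->
  lbound z (f / g - 1).
Proof.
move=> g0 fg; have -> : f / g - 1 = (f - g) / g by rewrite mulrBl divff.
have -> : z = (ldeg g + z) + ldeg g^-1 by rewrite ldegV//; lia.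
by apply: lboundM => //; exact: ldeg_lbound.
Qed.

Lemma lnorm_lt_lbound z f : lnorm f < #|F|%:R ^ (z + 1) -> lbound z f.
Proof.
have q1 : 1 < #|F|%:R :> rat by rewrite ltr1n finNzRing_gt1.
rewrite /lnorm; have [->//|f0] := eqVneq f 0; rewrite ltr_eXz2l// => fz.
by apply: lbound_le (@ldeg_lbound _ f); lia.
Qed.

Lemma lnorm_small (e : rat) : 0 < e -> exists k : nat,
  forall f, lbound (- k%:Z) f -> lnorm f < e.
Proof.
move=> e0; exists (Num.bound e^-1) => f /lnorm_le; move/le_lt_trans; apply.
set k := Num.bound _; have q1 : (2%:R : rat) <= #|F|%:R by rewrite ler_nat finNzRing_gt1.
rewrite -exprnN invf_plt ?posrE//; last by rewrite exprn_gt0// (lt_le_trans _ q1).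
apply: lt_le_trans (upper_nthrootP (leqnn k)) _.
by apply: lerXn2r => //; rewrite nnegrE// (le_trans _ q1).
Qed.

End OneUnits.

(** * The diagonal torus and the stabilizer of a lattice *)

Section Torus.
Variables (F : finFieldType) (n : nat).
Local Notation K := (laurent F).
Local Notation torus := (diagSL K n).
Implicit Types (a b : torus) (g : SL K n).

Definition tentry a (i : 'I_n) : K := SL_mx (diagSL_SL a) i i.

Definition tdeg a (i : 'I_n) : int := ldeg (tentry a i).

Lemma torus_offdiag a i j : i != j -> SL_mx (diagSL_SL a) i j = 0.
Proof. by move=> ij; case: a => a /= /is_diag_mxP; apply; exact: ij. Qed.

Lemma torus_mxE a : SL_mx (diagSL_SL a) = diag_mx (\row_i tentry a i).
Proof.
apply/matrixP => i j; rewrite !mxE.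
by have [->|ij] := eqVneq i j; [rewrite mulr1n|rewrite mulr0n torus_offdiag].
Qed.

Lemma torus_ext a b : tentry a =1 tentry b -> a = b.
Proof.
move=> ab; apply/val_inj/val_inj => /=; rewrite !torus_mxE.
by congr diag_mx; apply/rowP => i; rewrite !mxE ab.
Qed.

Lemma torus_valM a b :
  SL_mx (diagSL_SL (a * b)%g) = SL_mx (diagSL_SL a) *m SL_mx (diagSL_SL b).
Proof. by []. Qed.

Lemma tentry1 i : tentry 1%g i = 1.
Proof. by rewrite /tentry /= mxE eqxx. Qed.

Lemma tentryM a b i : tentry (a * b)%g i = tentry a i * tentry b i.
Proof.
by rewrite [LHS]/tentry torus_valM [SL_mx (diagSL_SL a)]torus_mxE mul_diag_mx !mxE.
Qed.

Lemma prod_tentry a : \prod_i tentry a i = 1.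
Proof.
apply: etrans (det_SL (diagSL_SL a)); rewrite torus_mxE det_diag.
by apply: eq_bigr => i _; rewrite mxE.
Qed.

Lemma tentry_neq0 a i : tentry a i != 0.
Proof.
apply/negP => /eqP ai0; have := prod_tentry a.
by rewrite (bigD1 i)//= ai0 mul0r => /esym/eqP; rewrite oner_eq0.
Qed.

Lemma tentryV a i : tentry a^-1%g i = (tentry a i)^-1.
Proof.
apply: (mulfI (tentry_neq0 a i)); rewrite -tentryM mulgV tentry1.
by rewrite mulfV// tentry_neq0.
Qed.

Lemma torus_mulgC a b : (a * b = b * a)%g.
Proof. by apply: torus_ext => i; rewrite !tentryM mulrC. Qed.

Lemma tdegM a b i : tdeg (a * b)%g i = tdeg a i + tdeg b i.
Proof. by rewrite /tdeg tentryM ldegM// tentry_neq0. Qed.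

Lemma tdegV a i : tdeg a^-1%g i = - tdeg a i.
Proof. by rewrite /tdeg tentryV ldegV// tentry_neq0. Qed.

Lemma tdeg1 i : tdeg 1%g i = 0.
Proof. by rewrite /tdeg tentry1; exact: ldeg1. Qed.

Lemma sum_tdeg a : \sum_i tdeg a i = 0.
Proof.
rewrite /tdeg -ldeg_prod ?prod_tentry; first exact: ldeg1.
by move=> i _; exact: tentry_neq0.
Qed.

Lemma mk_torus (v : 'I_n -> K) : \prod_i v i = 1 -> exists a, tentry a =1 v.
Proof.
move=> v1; have d1 : \det (diag_mx (\row_i v i)) == 1.
  by rewrite det_diag; apply/eqP; apply: etrans v1; apply: eq_bigr => i _; rewrite mxE.
have dd : SL_diag (MkSL d1) by exact: diag_mx_is_diag.
by exists (MkDiagSL dd) => i; rewrite /tentry /= !mxE eqxx mulr1n.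
Qed.

(** The monomials t^(d i) serve as entries. *)
Lemma mk_torus_deg (d : 'I_n -> int) : \sum_i d i = 0 ->
  exists a, tdeg a =1 d.
Proof.
move=> d0; pose v i : K := lmono 1 (d i).
have v0 i : v i != 0 by apply: lmono_neq0; exact: oner_neq0.
have vd : \prod_i v i = 1.
  pose P (f : K) (z : int) := f = lmono 1 z.
  suff : P (\prod_i v i) (\sum_i d i) by rewrite d0.
  apply: (big_ind2 P) => // f1 z1 f2 z2 -> ->.
  by rewrite /P lmonoM mulr1.
have [a av] := mk_torus vd; exists a => i; rewrite /tdeg av.
by apply: ldeg_mono; exact: oner_neq0.
Qed.

End Torus.

Section Stabilizer.
Variables (F : finFieldType) (n : nat).
Local Notation K := (laurent F).
Local Notation Gam := (@SL_poly F n).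

Lemma SL_poly1 : Gam 1%g.
Proof. by exists 1%g; rewrite /= map_mx1. Qed.

Lemma SL_polyM (g h : SL K n) : Gam g -> Gam h -> Gam (g * h)%g.
Proof. by move=> [P gP] [Q hQ]; exists (P * Q)%g; rewrite /= gP hQ map_mxM. Qed.

(** The inverse over F[t] maps to an inverse over K, and inverses are unique. *)
Lemma SL_polyV (g : SL K n) : Gam g -> Gam g^-1%g.
Proof.
move=> [P gP]; exists P^-1%g.
have h : SL_mx g^-1%g *m SL_mx g = 1%:M by rewrite /= mulVmx ?SL_unit.
rewrite -[RHS]mul1mx -h -mulmxA gP -map_mxM /=.
by rewrite mulmxV ?SL_unit// map_mx1 mulmx1.
Qed.

Lemma diag_stabP (g : SL K n) (a : diagSL K n) :
  diag_stab (coset_proj Gam g) a <-> Gam (g^-1 * diagSL_SL a * g)%g.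
Proof.
split=> [ax|aG].
  have : coset_set (coset_proj Gam g) (diagSL_SL a * g)%g.
    rewrite -ax /=; exists g => //; exists 1%g; [exact: SL_poly1|].
    by rewrite mulg1.
  by case=> l Gl agl; rewrite -mulgA -agl mulKg.
apply: val_inj; apply/seteqP; split=> x /=.
  case=> _ [l Gl <-] <-; exists (g^-1 * diagSL_SL a * g * l)%g.
    exact: SL_polyM.
  by rewrite !mulgA mulgV mul1g.
case=> l Gl <-; exists (g * ((g^-1 * diagSL_SL a * g)^-1 * l))%g.
  by exists ((g^-1 * diagSL_SL a * g)^-1 * l)%g => //; apply: SL_polyM => //; exact: SL_polyV.
by rewrite !invgM invgK !mulgA mulgK mulgV mul1g.
Qed.

(** P has determinant 1 because a and g have, so it lies in SL_n(F[t]). *)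
Lemma diag_stab_polyP (g : SL K n) (a : diagSL K n) :
  diag_stab (coset_proj Gam g) a <->
  exists P : 'M[{poly F}]_n,
    SL_mx (diagSL_SL a) *m SL_mx g = SL_mx g *m map_mx (@poly_laurent F) P.
Proof.
rewrite diag_stabP; split=> [[P gP]|[P gP]].
  exists (SL_mx P); rewrite -gP /=.
  by rewrite -!mulmxA mulKVmx// SL_unit.
have dP : \det P == 1.
  apply/eqP/poly_laurent_inj; rewrite -det_map_mx rmorph1.
  have := congr1 determinant gP; rewrite !det_mulmx !det_SL !mul1r.
  by move=> <-.
by exists (MkSL dP); rewrite /= -mulmxA gP mulKmx// SL_unit.
Qed.

Lemma diag_stab_closed (g : SL K n) :
  group_closed (mem (diag_stab (coset_proj Gam g))).
Proof.
split=> [|a b].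
  rewrite !inE; apply/diag_stabP; rewrite /= mulg1 mulVg; exact: SL_poly1.
rewrite !inE => /diag_stabP Ga /diag_stabP Gb; apply/diag_stabP.
have -> : (g^-1 * diagSL_SL (a / b) * g =
   (g^-1 * diagSL_SL a * g) * (g^-1 * diagSL_SL b * g)^-1)%g.
  rewrite !invgM invgK !mulgA mulgK.
  by congr (_ * _)%g; rewrite -!mulgA.
by apply: SL_polyM => //; exact: SL_polyV.
Qed.

End Stabilizer.

(** * Dirichlet's unit theorem: degrees modulo units *)

Section EnoughUnits.
Variables (F : finFieldType) (n : nat).
Local Notation K := (laurent F).
Local Notation pl := (@poly_laurent F).

Variables (v : 'I_n -> 'I_n -> K).

(** With v j the conjugates of the j-th generator of an F[t]-module in k, this
    is the i-th conjugate of its element with coordinates c. *)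
Definition polycomb (c : 'I_n -> {poly F}) (i : 'I_n) : K :=
  \sum_j pl (c j) * v j i.

Lemma polycombB c c' i :
  polycomb (fun j => c j - c' j) i = polycomb c i - polycomb c' i.
Proof.
by rewrite /polycomb -sumrB; apply: eq_bigr => j _; rewrite rmorphB mulrBl.
Qed.

(** Pigeonhole. Let N bound the degrees of the v j i and D the d i. A family c
    with entries of degree at most D has n (D + 1) free coefficients, and its
    i-th conjugate has degree at most D + N; for this degree to be at most
    d i + N, as many as D - d i coefficients have to vanish. That makes n D
    conditions, since the d i add up to zero. So two distinct families have the
    same coefficients there, and their difference is the witness. *)
Lemma minkowski : (0 < n)%N -> exists C0 : nat, forall d : 'I_n -> int,
  \sum_i d i = 0 -> exists c : 'I_n -> {poly F},
    (exists j, c j != 0) /\ forall i, lbound (d i + C0%:Z) (polycomb c i).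
Proof.
move=> n0.
have [N vN] : exists N : nat, forall j i, lbound N%:Z (v j i).
  exists (\sum_j \sum_i `|ldeg (v j i)|)%N => j i.
  apply: lbound_le (@ldeg_lbound _ _).
  rewrite (bigD1 j)//= (bigD1 i)//=; lia.
exists N => d d0; pose D := (\sum_i `|d i|)%N.
have dD i : d i <= D%:Z by rewrite /D (bigD1 i)//=; lia.
pose T1 : finType := {ffun 'I_n * 'I_D.+1 -> F}.
pose J := {i : 'I_n & 'I_`|D%:Z - d i|}.
pose T2 : finType := {ffun J -> F}.
pose cf (p : T1) j := \poly_(k < D.+1) p (j, inord k).
pose f (p : T1) : T2 :=
  [ffun x : J => polycomb (cf p) (tag x) (d (tag x) + N%:Z + 1 + (tagged x)%:Z)].
have finj : ~~ injectiveb f.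
  apply/negP => /injectiveP/leq_card; rewrite !card_ffun card_prod !card_ord.
  rewrite card_tagged sumnE big_map big_enum /=.
  under eq_bigr do rewrite card_ord.
  rewrite leq_exp2l ?finNzRing_gt1//.
  have -> : (\sum_i `|D%:Z - d i| = n * D)%N.
    apply/eqP; rewrite -eqz_nat (big_morph Posz PoszD (erefl _)).
    have -> : \sum_(i < n) `|D%:Z - d i|%N%:Z = \sum_(i < n) (D%:Z - d i).
      by apply: eq_bigr => i _; have := dD i; lia.
    by rewrite sumrB d0 sumr_const card_ord; lia.
  by rewrite leq_mul2l ltnn orbF; lia.
have [p [q [pq fpq]]] : exists p q, p != q /\ f p = f q.
  move: finj => /injectivePn[p [q pq fpq]]; by exists p, q.
exists (fun j => cf p j - cf q j); split.
  have [[j k] pqk] : exists jk, p jk != q jk.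
    apply/existsP; rewrite -negb_forall; apply: contra pq => /forallP pq.
    by apply/eqP/ffunP => x; exact/eqP.
  exists j; apply: contraNneq pqk => /polyP/(_ k).
  rewrite coefB !coef_poly ltn_ord inord_val coef0 => /eqP.
  by rewrite subr_eq0.
move=> i m mi.
have cfb (r : T1) : lbound (D%:Z + N%:Z) (polycomb (cf r) i).
  apply: lbound_sum => j _; apply: lboundM => //.
  by apply: lbound_poly; exact: size_poly.
have [mD|Dm] := ltP (D%:Z + N%:Z) m.
  by rewrite polycombB /= !cfb// subrr.
have mlt : (`|(m - (d i + N%:Z + 1))%R| < `|(D%:Z - d i)%R|)%N by have := dD i; lia.
move: fpq => /ffunP/(_ (Tagged (fun i => 'I_`|D%:Z - d i|) (Ordinal mlt))).
rewrite !ffunE /=.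
have -> : d i + N%:Z + 1 + `|(m - (d i + N%:Z + 1))%R|%N%:Z = m by lia.
by rewrite polycombB /= => ->; rewrite subrr.
Qed.

Variables (g : SL K n) (C : 'I_n -> 'M[{poly F}]_n).
Hypothesis vg : forall j,
  diag_mx (\row_i v j i) *m SL_mx g = SL_mx g *m map_mx pl (C j).
Hypothesis v_free : forall c : 'I_n -> {poly F},
  (exists j, c j != 0) -> forall i, polycomb c i != 0.

Lemma polycomb_mx c :
  diag_mx (\row_i polycomb c i) *m SL_mx g =
  SL_mx g *m map_mx pl (\sum_j c j *: C j).
Proof.
have -> : diag_mx (\row_i polycomb c i) =
    \sum_j pl (c j) *: diag_mx (\row_i v j i).
  apply/matrixP => i k; rewrite summxE !mxE; under eq_bigr do rewrite !mxE.
  have [->|ik] := eqVneq i k.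
    by rewrite mulr1n; apply: eq_bigr => j _; rewrite mulr1n.
  by rewrite mulr0n big1// => j _; rewrite mulr0n mulr0.
rewrite mulmx_suml map_mx_sum mulmx_sumr; apply: eq_bigr => j _.
by rewrite -scalemxAl vg map_mxZ -scalemxAr.
Qed.

Lemma polycomb_det c :
  pl (\det (\sum_j c j *: C j)) = \prod_i polycomb c i.
Proof.
have := congr1 determinant (polycomb_mx c).
rewrite !det_mulmx det_SL mulr1 mul1r det_diag -det_map_mx => <-.
by apply: eq_bigr => i _; rewrite mxE.
Qed.

(** If A and B are the matrices of two elements of norm h and A = B + h R, then
    A B^-1 = A adj(B) / h = 1 + R adj(B) is again a polynomial matrix; its
    eigenvalues are the quotients of the conjugates. *)
Lemma polycomb_quotient c c' (h : {poly F}) :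
  (exists j, c' j != 0) ->
  \det (\sum_j c j *: C j) = h -> \det (\sum_j c' j *: C j) = h ->
  (forall i k, (\sum_j c j *: C j) i k %% h = (\sum_j c' j *: C j) i k %% h) ->
  exists2 l : diagSL K n, diag_stab (coset_proj (@SL_poly F n) g) l &
    forall i, tentry l i = polycomb c i / polycomb c' i.
Proof.
move=> c'n0; set A := \sum_j c j *: C j; set B := \sum_j c' j *: C j.
move=> detA detB AB.
have y0 i : polycomb c' i != 0 by exact: v_free.
have plh0 : pl h != 0.
  by rewrite -detB polycomb_det; apply/prodf_neq0 => i _.
have [l lE] : exists l : diagSL K n,
    tentry l =1 (fun i => polycomb c i / polycomb c' i).
  apply: mk_torus; rewrite big_split /= -polycomb_det detA.
  by rewrite prodfV -polycomb_det detB divff.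
exists l => //; apply/diag_stab_polyP.
pose Q := 1%:M + (\matrix_(i, k) ((A i k - B i k) %/ h)) *m \adj B.
have hQ : A *m \adj B = h *: Q.
  have -> : A = B + h *: (\matrix_(i, k) ((A i k - B i k) %/ h)).
    apply/matrixP => i k; rewrite !mxE mulrC divpK ?subrKC//.
    by rewrite /dvdp modpD modpN AB subrr.
  rewrite mulmxDl mul_mx_adj detB -scalemxAl /Q scalerDr.
  by rewrite scalemx1; congr (_ + h *: (_ *m _)); apply/matrixP => i k; rewrite !mxE addrAC subrr add0r mulKp.
exists Q; apply: (scalerI plh0).
have adjB : SL_mx g *m map_mx pl (\adj B) =
    pl h *: (diag_mx (\row_i (polycomb c' i)^-1) *m SL_mx g).
  have yV : diag_mx (\row_i (polycomb c' i)^-1) *m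
      diag_mx (\row_i polycomb c' i) = 1%:M.
    rewrite mulmx_diag; apply/matrixP => i k; rewrite !mxE mulVf//.
  rewrite -[LHS]mul1mx -yV -mulmxA (mulmxA (diag_mx (\row_i polycomb c' i))).
  rewrite polycomb_mx -/B -(mulmxA (SL_mx g)) -map_mxM mul_mx_adj detB.
  by rewrite map_scalar_mx mul_mx_scalar -scalemxAr.
rewrite scalemxAl scalemxAr -map_mxZ -hQ map_mxM mulmxA -polycomb_mx.
rewrite -mulmxA adjB -scalemxAr -scalemxAl; congr (_ *: _).
rewrite mulmxA mulmx_diag torus_mxE.
have -> : \row_i tentry l i = \row_j ((\row_i polycomb c i) 0 j *
    (\row_i (polycomb c' i)^-1) 0 j) by apply/rowP => i; rewrite !mxE lE.
by [].
Qed.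

(** The degree vectors attained on the stabilizer have finite index among all
    integer vectors of sum zero. Stated as a finite classification of the torus,
    this transfers directly to finer congruence subgroups. *)
Definition finite_index_mod_units (g : SL K n) :=
  exists (I : finType) (phi : diagSL K n -> I), forall a b, phi a = phi b ->
    exists2 l, diag_stab (coset_proj (@SL_poly F n) g) l &
      forall i, tdeg a i = tdeg b i + tdeg l i.

(** The finite set of invariants consists of the excesses e, whose sum with the
    degree of the norm is n C0, of the norm itself, and of the matrix modulo the
    norm. Equal invariants give a unit by polycomb_quotient, and equal excesses
    say that the degrees of this unit are the differences of the two degree
    vectors. *)
Lemma enough_units : (0 < n)%N -> finite_index_mod_units g.
Proof.
move=> n0; have [C0 /= mink] := minkowski n0.
have /choice[c cP] : forall a : diagSL K n, exists c : 'I_n -> {poly F},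
    (exists j, c j != 0) /\
    forall i, lbound (tdeg a i + C0%:Z) (polycomb c i).
  by move=> a; apply: mink; exact: sum_tdeg.
pose B a := \sum_j c a j *: C j; pose h a := \det (B a).
pose e a i := `|(tdeg a i + C0%:Z - ldeg (polycomb (c a) i))%R|%N.
pose W := (n * C0)%N.
have y0 a i : polycomb (c a) i != 0 by apply: v_free; case: (cP a).
have h0 a : h a != 0.
  by rewrite -poly_laurent_eq0 polycomb_det; apply/prodf_neq0 => i _.
have eE a i : (e a i)%:Z = tdeg a i + C0%:Z - ldeg (polycomb (c a) i).
  by rewrite gez0_abs// subr_ge0; exact: ldeg_le (y0 a i) ((cP a).2 i).
have sum_e a : (\sum_i e a i + (size (h a)).-1 = W)%N.
  apply/eqP; rewrite -eqz_nat PoszD (big_morph Posz PoszD (erefl _)).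
  under eq_bigr do rewrite eE.
  rewrite sumrB big_split /= sum_tdeg sumr_const card_ord -ldeg_prod//.
  rewrite -polycomb_det -/(B a) -/(h a) ldeg_poly//.
  by rewrite subrK add0r /W PoszM -mulr_natl natz.
have eW a i : (e a i < W.+1)%N by rewrite -(sum_e a) (bigD1 i)//=; lia.
have hW a : (size (h a) <= W.+1)%N by rewrite -(sum_e a); lia.
exists ({ffun 'I_n -> 'I_W.+1} * 'rV[F]_W.+1 * {ffun 'I_n * 'I_n -> 'rV[F]_W.+1})%type.
exists (fun a => ([ffun i => inord (e a i)], poly_rV (h a),
  [ffun ik : 'I_n * 'I_n => poly_rV (B a ik.1 ik.2 %% h a)])) => a b [eab hab Bab].
have {}hab : h a = h b by rewrite -(poly_rV_K (hW a)) hab poly_rV_K.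
have {}eab i : e a i = e b i.
  move/ffunP/(_ i): eab; rewrite !ffunE => /(congr1 val) /=.
  by rewrite !inordK.
have {}Bab i k : B a i k %% h a = B b i k %% h a.
  move/ffunP/(_ (i, k)): Bab; rewrite !ffunE /= -hab => /(congr1 rVpoly).
  by rewrite !poly_rV_K// (leq_trans _ (hW a))// ltnW// ltn_modp.
have [l lstab lE] := polycomb_quotient (cP b).1 (erefl (h a)) (esym hab) Bab.
exists l => // i; rewrite [tdeg l i]/tdeg lE ldegM ?invr_eq0// ldegV//.
by have := eE a i; have := eE b i; have := eab i; lia.
Qed.

End EnoughUnits.

(** * From proportional forms to a commutative order *)

Section ProportionalForms.
Variables (K : fieldType) (n : nat) (u : nat -> K).
Hypothesis u_inj : injective u.
Implicit Types G M N : 'M[K]_n.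

Lemma linear_form_prod_mulmx G x :
  linear_form_prod G x = \prod_i (G *m x) i 0.
Proof. by apply: eq_bigr => i _; rewrite mxE. Qed.

Lemma poly_nonroot (p : {poly K}) : p != 0 -> exists x, p.[x] != 0.
Proof.
move=> p0; apply: contrapT => /forallNP H.
have := @max_poly_roots _ p [seq u k | k <- iota 0 (size p)] p0.
rewrite map_inj_uniq// iota_uniq size_map size_iota ltnn.
suff -> : all (root p) [seq u k | k <- iota 0 (size p)] by move=> /(_ isT isT).
by apply/allP => _ /mapP[k _ ->]; apply: contraT => /H.
Qed.

(** If every row j of N had a nonzero entry at some place other than i, the
    polynomials q j whose coefficients are these other entries would have a
    common non-root x, and the vector of powers of x with its i-th coordinate
    set to 0 would contradict the identity. *)
Lemma prod_coord_monomial N c : c != 0 ->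
  (forall y : 'cV[K]_n, \prod_i y i 0 = c * \prod_i (N *m y) i 0) ->
  exists2 j : 'I_n -> 'I_n, injective j &
    forall i, N (j i) i != 0 /\ forall l, l != i -> N (j i) l = 0.
Proof.
move=> c0 NP.
have rowN i : exists j, forall l, l != i -> N j l = 0.
  apply: contrapT => /forallNP H.
  pose q j := \poly_(l < n) (if insub l is Some l' then
    if l' == i then 0 else N j l' else 0).
  have q0 j : q j != 0.
    have /existsNP[l /not_implyP[li Njl]] := H j.
    apply: contra_not_neq Njl => /polyP/(_ l).
    by rewrite coef_poly ltn_ord valK (negPf li) coef0.
  have /poly_nonroot[x] : \prod_j q j != 0 by apply/prodf_neq0.
  rewrite horner_prod; apply/negP; rewrite negbK.
  have := NP (\col_l if l == i then 0 else x ^+ l).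
  rewrite (bigD1 i)//= mxE eqxx mul0r => /esym/eqP; rewrite mulf_eq0 (negPf c0).
  move=> /eqP E; apply/eqP; rewrite -[RHS]E; apply: eq_bigr => j _.
  rewrite mxE horner_poly; apply: eq_bigr => l _; rewrite valK mxE.
  by case: eqP; rewrite ?mul0r ?mulr0.
have [j jP] := choice rowN.
have Nji i : N (j i) i != 0.
  have := NP (const_mx 1); rewrite [LHS]big1 => [|l _]; last by rewrite mxE.
  move=> E; have : \prod_i (N *m const_mx 1) i (0 : 'I_1) != 0.
    by apply: contraTneq (oner_neq0 K) => E0; rewrite E E0 mulr0 eqxx.
  move=> /prodf_neq0/(_ (j i) isT); rewrite mxE (bigD1 i)//= big1 ?addr0.
    by rewrite mxE mulr1.
  by move=> l li; rewrite jP ?mul0r.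
exists j => [i i' jj|i]; last by split=> [//|l]; exact: jP.
apply/eqP/negPn/negP => ii'.
by have := Nji i; rewrite jj jP// eqxx.
Qed.

Lemma proportional_rows G M : G \in unitmx ->
  proportional (linear_form_prod G) (linear_form_prod M) ->
  exists (j : 'I_n -> 'I_n) (nu : 'I_n -> K), injective j /\
    forall i, nu i != 0 /\ forall l, M (j i) l = nu i * G i l.
Proof.
move=> Gu [c c0 GM]; pose N := M *m invmx G.
have [|j jinj jP] := @prod_coord_monomial N c c0.
  move=> y; have := GM (invmx G *m y).
  by rewrite !linear_form_prod_mulmx mulKVmx// mulmxA.
exists j, (fun i => N (j i) i); split=> // i; have [Ni Nl] := jP i; split=> // l.
have -> : M = N *m G by rewrite mulmxKV.
rewrite mxE (bigD1 i)//= big1 ?addr0// => m mi.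
by rewrite Nl ?mul0r.
Qed.

End ProportionalForms.

Lemma common_denominator (F : finFieldType) (I : finType)
    (x : I -> {fraction {poly F}}) :
  exists (f : {poly F}) (y : I -> {poly F}), f != 0 /\
    forall i, FracField.tofrac f * x i = FracField.tofrac (y i).
Proof.
have /choice[p /choice[q pq]] : forall i, exists p q : {poly F},
    q != 0 /\ x i = FracField.tofrac p / FracField.tofrac q.
  by move=> i; exact: fractionP.
exists (\prod_i q i), (fun i => p i * \prod_(l | l != i) q l); split.
  by apply/prodf_neq0 => i _; case: (pq i).
move=> i; have [q0 ->] := pq i; rewrite (bigD1 i)//= !rmorphM.
by rewrite mulrC mulrA divfK ?tofrac_eq0.
Qed.

Section SplitField.
Variables (F : finFieldType) (n : nat) (k : fieldExtType {fraction {poly F}}).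
Local Notation K := (laurent F).

Lemma embeddingZ (s : {rmorphism k -> K}) r x :
  embedding s -> s (r *: x) = fraction_laurent r * s x.
Proof. by move=> se; rewrite -mulr_algl rmorphM se. Qed.

(** The structure constants of k in the basis alpha become polynomials after
    multiplication by f, and C jj is the matrix of multiplication by f times the
    jj-th basis vector. Row i of g is proportional to the i-th conjugates of
    alpha, which is exactly the eigenvector equation required. *)
Lemma split_field_units (alpha : n.-tuple k) (s : 'I_n -> {rmorphism k -> K})
    (g : SL K n) :
  (0 < n)%N -> basis_of {:k} alpha -> all_embeddings s ->
  proportional (linear_form_prod g)
    (linear_form_prod (\matrix_(i, j) s i (tnth alpha j))) ->
  finite_index_mod_units g.
Proof.
move=> n0 alphaB [s_emb s_inj s_all].
have u_inj : injective (fun m : nat => lmono 1 m%:Z : K).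
  move=> a b /(congr1 (@ldeg F)).
  by rewrite !ldeg_mono ?oner_neq0// => -[].
move=> /(proportional_rows u_inj (SL_unit g))[j [nu [j_inj nuP]]].
pose s' i := s (j i).
have s'E i l : s' i (tnth alpha l) = nu i * SL_mx g i l.
  by have [_ <-] := nuP i; rewrite mxE.
pose T (x : 'I_n * 'I_n * 'I_n) :=
  coord alpha x.2 (tnth alpha x.1.1 * tnth alpha x.1.2).
have [f [y [f0 yP]]] := common_denominator T.
have plT x : poly_laurent (y x) = poly_laurent f * fraction_laurent (T x).
  by rewrite -!fraction_laurent_tofrac -yP rmorphM.
pose v jj i := poly_laurent f * s' i (tnth alpha jj).
pose C jj : 'M[{poly F}]_n := \matrix_(m, l) y (jj, l, m).
apply: (@enough_units F n v g C) => //.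
  move=> jj; apply/matrixP => i l; apply: (mulfI (nuP i).1).
  rewrite mul_diag_mx !mxE mulrCA -s'E /v -mulrA -rmorphM.
  rewrite (coord_basis alphaB (memvf (tnth alpha jj * tnth alpha l))).
  rewrite rmorph_sum !mulr_sumr; apply: eq_bigr => m _.
  rewrite !mxE (embeddingZ _ _ (s_emb _)) -tnth_nth s'E plT /T /=.
  by rewrite mulrA mulrCA; congr (_ * _); rewrite mulrC.
move=> c [jj cj] i; have -> : polycomb v c i =
    s' i (\sum_j FracField.tofrac (c j * f) *: tnth alpha j).
  rewrite rmorph_sum; apply: eq_bigr => l _.
  rewrite (embeddingZ _ _ (s_emb _)) fraction_laurent_tofrac rmorphM /v.
  by rewrite mulrA.
rewrite fmorph_eq0; apply: contraNneq cj => H.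
have /freeP := basis_free alphaB.
move=> /(_ (fun j => FracField.tofrac (c j * f))).
under eq_bigr do rewrite -tnth_nth.
move=> /(_ H jj)/eqP; rewrite tofrac_eq0 mulf_eq0 (negPf f0) orbF.
by [].
Qed.

End SplitField.

(** * Invariant measures on quotients of filtered abelian groups *)

Section Cosets.
Variables (H : groupType) (Lam : set H).
Hypothesis LamG : group_closed (mem Lam).
Implicit Types x y a : H.

Lemma group_closed1 : Lam 1%g.
Proof. by have [+ _] := LamG; rewrite inE. Qed.

Lemma group_closedV x : Lam x -> Lam x^-1%g.
Proof.
have [_ LV] := LamG => Lx; have := LV 1%g x; rewrite mul1g !inE; apply=> //.
exact: group_closed1.
Qed.

Lemma group_closedM x y : Lam x -> Lam y -> Lam (x * y)%g.
Proof.
have [_ LV] := LamG => Lx /group_closedV Ly.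
by have := LV x y^-1%g; rewrite invgK !inE; apply.
Qed.

Lemma coset_projP x y : coset_proj Lam x = coset_proj Lam y <-> Lam (x^-1 * y)%g.
Proof.
split=> [xy|Lxy].
  have : coset_set (coset_proj Lam y) y.
    by exists 1%g; [exact: group_closed1|rewrite mulg1].
  by rewrite -xy => -[l Ll <-]; rewrite mulKg.
apply: val_inj; apply/seteqP; split=> _ [l Ll <-] /=.
  exists ((x^-1 * y)^-1 * l)%g; first by apply: group_closedM => //; exact: group_closedV.
  by rewrite invgM invgK !mulgA mulgV mul1g.
by exists (x^-1 * y * l)%g; [exact: group_closedM|rewrite !mulgA mulgV mul1g].
Qed.

Lemma coset_proj_surj (c : coset_space Lam) : exists x, coset_proj Lam x = c.
Proof. by case: c => c cP; have /asboolP[x _ xc] := cP; exists x; exact: val_inj. Qed.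

Lemma coset_proj_act a x : coset_act a (coset_proj Lam x) = coset_proj Lam (a * x)%g.
Proof.
apply: val_inj => /=; rewrite /left_coset image_comp.
by apply: eq_imagel => l _ /=; rewrite mulgA.
Qed.

End Cosets.

(** The subgroups fil m play the role of congruence subgroups: H is complete for
    them, every open set is a union of their cosets, and Lam is cocompact in the
    sense that each Lam (fil m) has finite index. *)
Record filtration (H : topologyGroupType) (Lam : set H) := Filtration {
  fil :> nat -> set H;
  fil_mulC : forall x y : H, (x * y = y * x)%g;
  fil_lam : group_closed (mem Lam);
  fil_group : forall m, group_closed (mem (fil m));
  fil_decr : forall m, fil m.+1 `<=` fil m;
  fil_basis : forall (V : set H) x, open V -> V x ->
    exists m, forall u, fil m u -> V (x * u)%g;
  fil_complete : forall x : nat -> H, (forall m, fil m ((x m)^-1 * x m.+1)%g) ->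
    exists y, forall m, fil m ((x m)^-1 * y)%g;
  fil_finite : forall m, exists (I : finType) (phi : H -> I),
    forall x y, phi x = phi y ->
      exists l u, [/\ Lam l, fil m u & (y = x * l * u)%g] }.

Section Cells.
Variables (H : topologyGroupType) (Lam : set H) (U : filtration Lam).
Implicit Types (x y z : H) (S : set H) (m : nat).

Let mulC := fil_mulC U.

Let lam1 := group_closed1 (fil_lam U).
Let lamM := group_closedM (fil_lam U).
Let lamV := group_closedV (fil_lam U).
Let fil1 m := group_closed1 (fil_group U m).
Let filM m := group_closedM (fil_group U m).
Let filV m := group_closedV (fil_group U m).

(** The finite quotient of H by Lam (fil m) is handled through its fibres in H,
    the cells of level m. *)
Definition same_cell m x y :=
  exists l u, [/\ Lam l, U m u & (y = x * l * u)%g].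

Lemma same_cell_refl m x : same_cell m x x.
Proof. by exists 1%g, 1%g; split; [exact: lam1|exact: fil1|rewrite !mulg1]. Qed.

Lemma same_cell_sym m x y : same_cell m x y -> same_cell m y x.
Proof.
move=> [l [u [Ll Uu ->]]]; exists l^-1%g, u^-1%g.
split; [exact: lamV|exact: filV|].
by rewrite -(mulgA _ u) (mulC u) !mulgA mulgK mulgK.
Qed.

Lemma same_cell_trans m y x z :
  same_cell m x y -> same_cell m y z -> same_cell m x z.
Proof.
move=> [l [u [Ll Uu ->]]] [l' [u' [Ll' Uu' ->]]].
exists (l * l')%g, (u * u')%g; split; [exact: lamM|exact: filM|].
by rewrite -!mulgA; congr (_ * (_ * _))%g; rewrite !mulgA (mulC u).
Qed.

Lemma same_cell_mul m a x y : same_cell m x y -> same_cell m (a * x)%g (a * y)%g.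
Proof. by move=> [l [u [Ll Uu ->]]]; exists l, u; split=> //; rewrite !mulgA. Qed.

Lemma same_cell_lam m x l : Lam l -> same_cell m x (x * l)%g.
Proof. by exists l, 1%g; split; [|exact: fil1|rewrite mulg1]. Qed.

Lemma same_cell_fil m x u : U m u -> same_cell m x (x * u)%g.
Proof. by exists 1%g, u; split; [exact: lam1| |rewrite mulg1]. Qed.

Lemma same_cell_le m m' x y : (m <= m')%N -> same_cell m' x y -> same_cell m x y.
Proof.
move=> mm' [l [u [Ll Uu ->]]]; exists l, u; split=> //.
rewrite -(subnKC mm') in Uu; elim: (m' - m)%N Uu => [|j IHj]; first by rewrite addn0.
by rewrite addnS => /(@fil_decr _ _ U).
Qed.

(** The labels phi of the filtration may separate points of one cell; composing
    with a choice of representative that only depends on the cell repairs this.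
    *)
Lemma label_ex m : exists I : finType, exists label : H -> I,
  forall x y, label x = label y <-> same_cell m x y.
Proof.
have [I [phi phiP]] := fil_finite U m; exists I.
pose c x := xget 1%g [set y | same_cell m x y].
have cP x : same_cell m x (c x).
  by rewrite /c; apply: (@xgetPex _ _ [set y | same_cell m x y]); exists x; exact: same_cell_refl.
exists (phi \o c) => x y; split=> [/phiP xy|xy].
  apply: (same_cell_trans (cP x)); apply: same_cell_trans xy _.
  exact: same_cell_sym.
congr phi; rewrite /c; congr xget; apply/seteqP; split=> z /=.
  exact/same_cell_trans/same_cell_sym.
exact: same_cell_trans.
Qed.

Definition label_type m : finType := projT1 (cid (label_ex m)).
Definition label m : H -> label_type m := projT1 (cid (projT2 (cid (label_ex m)))).
Lemma labelP m x y : label m x = label m y <-> same_cell m x y.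
Proof. exact: (projT2 (cid (projT2 (cid (label_ex m))))). Qed.

Definition unlabel m (i : label_type m) : H := xget 1%g [set x | label m x = i].
Lemma labelK m x : label m (unlabel (label m x)) = label m x.
Proof. by rewrite /unlabel; apply: (@xgetPex _ _ [set y | label m y = label m x]); exists x. Qed.

Definition labels m S : {set label_type m} :=
  [set i | `[< exists2 x, S x & label m x = i >]]%SET.

Lemma in_labels m S i : reflect (exists2 x, S x & label m x = i) (i \in labels m S).
Proof. by rewrite inE; exact: asboolP. Qed.

(** For sets of level m this counts the cells they consist of. *)
Definition ncells m S := #|labels m S|.

Lemma ncells0 m : ncells m set0 = 0%N.
Proof. by apply/eqP; rewrite cards_eq0; apply/set0Pn => -[i /in_labels[]]. Qed.

Lemma ncells_gt0 m S x : S x -> (0 < ncells m S)%N.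
Proof. by move=> Sx; rewrite card_gt0; apply/set0Pn; exists (label m x); apply/in_labels; exists x. Qed.

Definition level m S := forall x y, same_cell m x y -> S x -> S y.

Lemma level_le m m' S : (m <= m')%N -> level m S -> level m' S.
Proof. by move=> mm' mS x y /(same_cell_le mm'); exact: mS. Qed.

Lemma ncellsU m S S' : level m S -> S `&` S' = set0 ->
  ncells m (S `|` S') = (ncells m S + ncells m S')%N.
Proof.
move=> lS SS'; rewrite /ncells.
have -> : labels m (S `|` S') = (labels m S :|: labels m S')%SET.
  apply/setP => i; rewrite finset.in_setU; apply/in_labels/orP.
    by move=> [x [Sx|Sx] xi]; [left|right]; apply/in_labels; exists x.
  by move=> [|] /in_labels[x Sx xi]; exists x => //; [left|right].
rewrite cardsU [X in (_ - X)%N](_ : _ = 0%N) ?subn0//.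
apply/eqP; rewrite cards_eq0; apply/set0Pn => -[i]; rewrite finset.in_setI => /andP[].
move=> /in_labels[x Sx xi] /in_labels[y Sy yi].
have : (S `&` S') y by split=> //; apply: lS Sx; apply/labelP; rewrite xi.
by rewrite SS'.
Qed.

Lemma ncells_le_mul m a S : (ncells m [set (a * x)%g | x in S] <= ncells m S)%N.
Proof.
pose h (i : label_type m) := label m (a * unlabel i)%g.
apply: leq_trans (leq_imset_card h (labels m S)).
apply/subset_leq_card/fintype.subsetP => i.
move=> /in_labels[_ [x Sx <-] <-]; apply/imsetP; exists (label m x).
  by apply/in_labels; exists x.
by apply/labelP/same_cell_mul/same_cell_sym/labelP; exact: labelK.
Qed.

Lemma ncells_mul m a S : ncells m [set (a * x)%g | x in S] = ncells m S.
Proof.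
apply/eqP; rewrite eqn_leq ncells_le_mul /=.
have {1}-> : S = [set (a^-1 * x)%g | x in [set (a * x)%g | x in S]].
  rewrite image_comp; apply/seteqP; split=> [x Sx|_ [x Sx <-] /=].
    by exists x => //=; rewrite mulKg.
  by rewrite mulKg.
exact: ncells_le_mul.
Qed.

(** All cells of level m are translates of one another, so they contain equally
    many cells of level m'. *)
Lemma ncells_refine m m' S : (m <= m')%N -> level m S ->
  ncells m' S = (ncells m S * ncells m' [set x | same_cell m 1%g x])%N.
Proof.
move=> mm' lS; pose tau (j : label_type m') := label m (unlabel j).
have tauE x : tau (label m' x) = label m x.
  by apply/labelP; apply: (same_cell_le mm'); apply/labelP; exact: labelK.
rewrite /ncells -sum1_card (partition_big tau (mem (labels m S))); last first.
  by move=> j /in_labels[x Sx <-]; rewrite tauE; apply/in_labels; exists x.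
rewrite -sum_nat_const; apply: eq_bigr => i /in_labels[x Sx xi].
rewrite sum1_card -/(ncells m' _) -(ncells_mul m' x) /ncells.
apply: eq_card => j; rewrite inE [in LHS]/in_mem /=; apply/andP/asboolP.
  move=> [/in_labels[y Sy yj] /eqP tj]; exists y => //=.
  exists (x^-1 * y)%g; last by rewrite mulVKg.
  by rewrite /= -(mulVg x); apply/same_cell_mul/labelP; rewrite xi -tj -yj tauE.
move=> [_ [z xz <-] zj].
have xxz : same_cell m x (x * z)%g.
  by rewrite -[X in same_cell _ X _](mulg1 x); exact: same_cell_mul.
split; first by apply/in_labels; exists (x * z)%g => //; exact: lS Sx.
by apply/eqP; rewrite -zj tauE -xi; apply/esym/labelP.
Qed.

(** The proportion of cells lying in S does not depend on the level. *)
Lemma ncells_ratio m m' S : (m <= m')%N -> level m S ->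
  (ncells m S * ncells m' setT = ncells m' S * ncells m setT)%N.
Proof.
move=> mm' lS; rewrite (ncells_refine mm' lS) (@ncells_refine _ _ setT mm')//.
by rewrite mulnA mulnAC.
Qed.

(** Koenig's lemma. If no finite subfamily covers A, then, as there are finitely
    many cells of each level, the same holds for the part of A in some cell of
    level 0, then in some cell of level 1 inside it, and so on. By completeness
    the nested cells have a common point, and it lies in A. The F i containing
    it contains a whole cell around it, hence almost all of the nested cells, a
    contradiction. *)
Lemma level_compact m (A : set H) (F : nat -> set H) : level m A ->
  (forall i, exists k, level k (F i)) -> A `<=` \bigcup_i F i ->
  exists N, A `<=` \bigcup_(i in [set i | (i < N)%N]) F i.
Proof.
move=> lA lF AF; apply: contrapT => nA.
pose good S := exists N, S `<=` \bigcup_(i in [set i | (i < N)%N]) F i.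
pose cell k x := A `&` [set y | same_cell k x y].
(* There are finitely many cells, so a bound on each bounds their union. *)
have good_cells k S : (forall y, S y -> good (cell k y)) -> good (A `&` [set z | exists2 y, S y & same_cell k y z]).
  move=> gS.
  have /choice[N NP] : forall i : label_type k, exists N, forall y, S y -> label k y = i ->
      cell k y `<=` \bigcup_(i in [set i | (i < N)%N]) F i.
    move=> i; have [[y Sy yi]|nS] := pselect (exists2 y, S y & label k y = i); last first.
      by exists 0%N => y Sy yi; case: nS; exists y.
    have [N NP] := gS y Sy; exists N => y' Sy' y'i z [Az y'z]; apply: NP; split=> //.
    by apply: same_cell_trans y'z; apply/labelP; rewrite yi.
  exists (\sum_i N i)%N => z [Az [y Sy yz]].
  have [i iN Fz] := NP (label k y) y Sy erefl z (conj Az yz).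
  by exists i => //=; apply: leq_trans iN _; rewrite (bigD1 (label k y))//= leq_addr.
have start : exists x, ~ good (cell 0%N x).
  apply: contrapT => /forallNP gx; apply: nA.
  have [|N NP] := good_cells 0%N setT; first by move=> y _; apply: contrapT => /gx.
  by exists N => z Az; apply: NP; split=> //; exists z => //; exact: same_cell_refl.
have step k x : exists y, ~ good (cell k x) ->
    U k (x^-1 * y)%g /\ ~ good (cell k.+1 y).
  have [gx|ngx] := pselect (good (cell k x)); first by exists x.
  apply: contrapT => /forallNP ny; apply: ngx.
  have [|N NP] := good_cells k.+1 [set y | U k (x^-1 * y)%g].
    move=> y /= xy; apply: contrapT => ngy; apply: (ny y) => _; by split.
  exists N => z [Az [l [u [Ll Uu zE]]]]; apply: NP; split=> //.
  exists (x * u)%g; first by rewrite /= mulKg.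
  by rewrite zE -mulgA (mulC l) mulgA; exact: same_cell_lam.
have [x0 ngx0] := start.
have /choice[f fP] : forall kx : nat * H, exists y, ~ good (cell kx.1 kx.2) ->
    U kx.1 (kx.2^-1 * y)%g /\ ~ good (cell kx.1.+1 y) by move=> [k x]; exact: step.
pose x := fix x k := if k is k'.+1 then f (k', x k') else x0.
have xbad k : ~ good (cell k (x k)).
  by elim: k => [//|k IHk]; have [] := fP (k, x k) IHk.
have [y yP] : exists y, forall k, U k ((x k)^-1 * y)%g.
  by apply: fil_complete => k; have [] := fP (k, x k) (xbad k).
have xy k : same_cell k (x k) y.
  by rewrite -[y](mulVKg (x k)); exact: same_cell_fil.
have Ay : A y.
  apply: contrapT => nAy; apply: (xbad m); exists 0%N => z [Az xz]; case: nAy.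
  by apply: lA Az; apply: same_cell_trans (xy m); exact: same_cell_sym.
have [i _ Fy] := AF _ Ay; have [k lFi] := lF i.
apply: (xbad k); exists i.+1 => z [_ xz]; exists i => //=.
apply: lFi Fy; apply: same_cell_trans xz; exact: same_cell_sym.
Qed.

End Cells.

(** A copy of H / Lam that carries, as its algebra of measurable sets, the
    unions of cells of some level. *)
Definition level_space (H : topologyGroupType) (Lam : set H)
  (U : filtration Lam) := coset_space Lam.

Section HaarMeasure.
Variables (R : realType) (H : topologyGroupType) (Lam : set H).
Variable U : filtration Lam.
Local Notation X := (level_space U).
Implicit Types (x y : H) (B : set (coset_space Lam)).

HB.instance Definition _ := Pointed.copy (level_space U) (coset_space Lam).

Definition pre B : set H := coset_proj Lam @^-1` B.

Let coset_projP := coset_projP (fil_lam U).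

Lemma pre_inj B B' : pre B = pre B' -> B = B'.
Proof.
move=> BB'; apply/seteqP; split=> c; have [x <-] := coset_proj_surj c.
  by rewrite -[B _]/(pre B x) BB'.
by rewrite -[B' _]/(pre B' x) -BB'.
Qed.

Lemma pre_act a B : pre (coset_act a @` B) = [set (a * x)%g | x in pre B].
Proof.
apply/seteqP; split=> x.
  move=> [c]; have [y <-] := coset_proj_surj c => By; rewrite coset_proj_act.
  move=> /coset_projP Lyx; exists (a^-1 * x)%g; last by rewrite mulVKg.
  rewrite /pre /=; have -> : coset_proj Lam (a^-1 * x)%g = coset_proj Lam y; last by [].
  apply/esym/coset_projP; move: Lyx; by rewrite invgM mulgA.
by move=> [y By <-]; exists (coset_proj Lam y) => //; exact: coset_proj_act.
Qed.

Definition level_set B := exists m, level U m (pre B).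

Lemma level_set0 : level_set set0. Proof. by exists 0%N. Qed.

Lemma level_setU : setU_closed level_set.
Proof.
move=> A B [m mA] [k kB]; exists (maxn m k) => x y xy.
case=> [Ax|Bx]; [left|right].
  by apply: mA Ax; apply: same_cell_le xy; rewrite leq_maxl.
by apply: kB Bx; apply: same_cell_le xy; rewrite leq_maxr.
Qed.

Lemma level_setC : setC_closed level_set.
Proof.
move=> A [m mA]; exists m => x y xy nAx Ay; apply: nAx; apply: mA Ay.
exact: same_cell_sym.
Qed.

HB.instance Definition _ := @isAlgebraOfSets.Build default_measure_display
  (level_space U) level_set level_set0 level_setU level_setC.

Definition level_of B := xget 0%N [set m | level U m (pre B)].

(** By ncells_ratio this does not depend on the level at which B is a union of
    cells. *)
Definition cell_content (B : set X) : \bar R :=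
  ((ncells U (level_of B) (pre B))%:R / (ncells U (level_of B) setT)%:R)%:E.

Lemma ncellsT_gt0 m : (0 < ncells U m setT)%N.
Proof. exact: (@ncells_gt0 _ _ _ _ _ 1%g). Qed.

Lemma ncellsT_neq0 m : (ncells U m setT)%:R != 0 :> R.
Proof. by rewrite pnatr_eq0 -lt0n ncellsT_gt0. Qed.

Lemma cell_contentE m B : level U m (pre B) ->
  cell_content B = ((ncells U m (pre B))%:R / (ncells U m setT)%:R)%:E.
Proof.
move=> mB; have kB : level U (level_of B) (pre B).
  by apply: (@xgetPex _ 0%N [set m | level U m (pre B)]); exists m.
rewrite /cell_content; set k := level_of B in kB *.
congr EFin; apply/eqP; rewrite eqr_div ?ncellsT_neq0// -!natrM eqr_nat.
have [mk|/ltnW km] := leqP m k; last by rewrite (ncells_ratio km).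
by rewrite -(ncells_ratio mk).
Qed.

Lemma cell_content_ge0 B : (0 <= cell_content B)%E.
Proof. by rewrite lee_fin divr_ge0. Qed.

Lemma cell_content0 : cell_content set0 = 0%E.
Proof.
by rewrite (@cell_contentE 0%N)// [pre set0](_ : _ = set0)// ncells0 mul0r.
Qed.

Lemma cell_contentT : cell_content setT = 1%E.
Proof.
by rewrite (@cell_contentE 0%N)// [pre setT](_ : _ = setT)// divff ?ncellsT_neq0.
Qed.

Lemma cell_contentU (A B : set X) : level_set A -> level_set B -> A `&` B = set0 ->
  cell_content (A `|` B) = (cell_content A + cell_content B)%E.
Proof.
move=> [m mA] [k kB] AB; pose M := maxn m k.
have MA : level U M (pre A) by apply: level_le mA; exact: leq_maxl.
have MB : level U M (pre B) by apply: level_le kB; exact: leq_maxr.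
have MAB : level U M (pre (A `|` B)).
  by move=> x y xy [Ax|Bx]; [left; exact: MA Ax|right; exact: MB Bx].
rewrite (cell_contentE MA) (cell_contentE MB) (cell_contentE MAB) -EFinD -mulrDl.
rewrite -natrD -ncellsU//; apply/seteqP; split=> x // [Ax Bx].
by have : (A `&` B) (coset_proj Lam x) by []; rewrite AB.
Qed.

Lemma cell_content_semi_additive : measure_function.semi_additive (cell_content : set X -> \bar R).
Proof.
apply/(additive2P cell_content0) => A B lA lB AB.
exact: cell_contentU.
Qed.

HB.instance Definition _ := isContent.Build default_measure_display X R
  cell_content cell_content_ge0 cell_content_semi_additive.

(** By compactness a countable cover by sets of the algebra has a finite
    subcover, so finite subadditivity suffices. *)
Lemma cell_content_sigma_subadditive :
  measurable_subset_sigma_subadditive (cell_content : set X -> \bar R).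
Proof.
move=> A F lF [m lA] AF.
have [N AN] : exists N, pre A `<=` \bigcup_(i in [set i | (i < N)%N]) pre (F i).
  apply: (level_compact lA) => [i|x Ax]; first exact: lF.
  by have [i _ Fi] := AF _ Ax; exists i.
have AFN : A `<=` \big[setU/set0]_(i < N) F i.
  move=> c; have [x <-] := coset_proj_surj c => Ax; rewrite -bigcup_mkord.
  by have [i iN Fi] := AN _ Ax; exists i.
have mA : measurable (A : set X) by exists m.
apply: le_trans (content_subadditive (cell_content : set X -> \bar R)
  (fun k _ => lF k) mA AFN) _.
rewrite -(big_mkord xpredT (fun k => cell_content (F k))).
by apply: nneseries_lim_ge => i _ _; exact: cell_content_ge0.
Qed.

HB.instance Definition _ := Content_SigmaSubAdditive_isMeasure.Build
  default_measure_display R X cell_content cell_content_sigma_subadditive.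

Let mu : {measure set X -> \bar R} := cell_content.

Local Open Scope ereal_scope.

Definition haar : set (g_sigma_algebraType (@open (coset_space Lam))) -> \bar R :=
  mu_ext mu.

(** An open set V is the countable union over m of the sets of all points whose
    cell of level m lies in V. *)
Lemma open_level_sigma (B : set (coset_space Lam)) :
  (@open (coset_space Lam)).-sigma.-measurable B ->
  (@measurable _ X).-sigma.-measurable B.
Proof.
apply: smallest_sub; first exact: smallest_sigma_algebra.
move=> V oV.
pose W m : set X := coset_proj Lam @`
  [set x | forall y, same_cell U m x y -> pre V y].
have preW m : pre (W m) = [set x | forall y, same_cell U m x y -> pre V y].
  apply/seteqP; split=> [x [x' x'W /coset_projP Lx] y xy|x xW]; last by exists x.
  apply: x'W; apply: same_cell_trans xy.
  by rewrite -[x](mulVKg x'); exact: same_cell_lam.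
have lW m : measurable (W m).
  by exists m; rewrite preW => x y xy xW z yz; apply: xW; exact: same_cell_trans yz.
have -> : V = \bigcup_m W m.
  apply: pre_inj; apply/seteqP; split=> x.
    move=> Vx; have [m mV] := fil_basis U (oV : open (pre V)) Vx.
    exists m => //; rewrite -[W m _]/(pre (W m) x) preW => y [l [u [Ll Uu ->]]].
    rewrite -mulgA (fil_mulC U l) mulgA /pre /=.
    have -> : coset_proj Lam (x * u * l)%g = coset_proj Lam (x * u)%g.
      by apply/esym/coset_projP; rewrite mulKg.
    exact: mV.
  move=> [m _]; rewrite -[W m _]/(pre (W m) x) preW; apply.
  exact: same_cell_refl.
by apply: sigma_algebra_bigcup => m; exact: sub_sigma_algebra.
Qed.

Lemma haar0 : haar set0 = 0. Proof. exact: mu_ext0. Qed.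

Lemma haar_ge0 B : 0 <= haar B. Proof. exact: mu_ext_ge0. Qed.

Lemma haar_sigma_additive : semi_sigma_additive haar.
Proof.
move=> F mF tF mUF.
apply: (@measure_semi_sigma_additive _ _ _ (measure_extension mu)) => //.
  by move=> i; exact: open_level_sigma (mF i).
exact: open_level_sigma mUF.
Qed.

HB.instance Definition _ := isMeasure.Build _ _ R haar
  haar0 haar_ge0 haar_sigma_additive.

Lemma haarT : haar setT = 1.
Proof.
apply: etrans (cell_contentT); apply: (measurable_mu_extE mu).
exact: measurableT.
Qed.

Lemma cell_content_act a B : level_set B ->
  level_set (coset_act a @` B) /\
  cell_content (coset_act a @` B) = cell_content B.
Proof.
move=> [m mB]; have mB' : level U m (pre (coset_act a @` B)).
  rewrite pre_act => x y xy [z Bz zx]; exists (a^-1 * y)%g; last by rewrite mulVKg.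
  apply: mB Bz; rewrite -[z](mulKg a) zx; exact: same_cell_mul.
split; first by exists m.
by rewrite (cell_contentE mB) (cell_contentE mB') pre_act ncells_mul.
Qed.

(** Translating a cover by sets of the algebra preserves its total content, so
    the outer measure itself is invariant. *)
Lemma haar_act_le a B : haar (coset_act a @` B) <= haar B.
Proof.
apply: le_ereal_inf_tmp => _ [F [mF BF] <-].
apply: ereal_inf_lbound; exists (fun k => coset_act a @` F k).
  split=> [k|c]; first by have [] := cell_content_act a (mF k).
  by move=> [c' /BF[k _ Fc'] <-]; exists k => //; exists c'.
by apply: eq_eseriesr => k _; have [] := cell_content_act a (mF k).
Qed.

Lemma haar_act a B : haar (coset_act a @` B) = haar B.
Proof.
apply/eqP; rewrite eq_le haar_act_le /=.
have {1}-> : B = coset_act a^-1%g @` (coset_act a @` B).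
  apply: pre_inj; rewrite !pre_act image_comp; apply/seteqP; split=> [x Bx|_ [x Bx <-]].
    by exists x => //=; rewrite mulKg.
  by rewrite /= mulKg.
exact: haar_act_le.
Qed.

Lemma filtration_invariant_measure :
  exists nu : {measure set (g_sigma_algebraType (@open (coset_space Lam)))
               -> \bar R},
    0 < nu setT < +oo /\
    forall (h : H) (B : set (coset_space Lam)),
      (@open (coset_space Lam)).-sigma.-measurable B ->
      nu (coset_act h @` B) = nu B.
Proof.
exists haar; split; last by move=> h B _; exact: haar_act.
by rewrite [X in 0 < X < _]haarT lte01 ltry.
Qed.

End HaarMeasure.

(** * The congruence filtration of the torus *)

Lemma cancel_commuting (G : groupType) (z l l' w w' : G) :
  (w * (l^-1 * l') = (l^-1 * l') * w)%g ->
  (z * l' * w' = z * l * w * (l^-1 * l') * (w^-1 * w'))%g.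
Proof. by move=> wl; rewrite -(mulgA _ w) wl !mulgA !mulgK. Qed.

Section TorusTopology.
Variables (F : finFieldType) (n : nat).
Local Notation K := (laurent F).
Local Notation torus := (diagSL K n).
Implicit Types (a b u : torus) (m : nat).

(** The maximal compact subgroup A_0 for m = 0, and its subgroup of elements
    congruent to 1 modulo t^-m in general. *)
Definition torus_fil m : set torus :=
  [set u | (forall i, tdeg u i = 0) /\ forall i, lbound (- m%:Z) (tentry u i - 1)].

Lemma torus_fil_group m : group_closed (mem (torus_fil m)).
Proof.
split=> [|a b]; rewrite !inE.
  by split=> i; [exact: tdeg1|rewrite tentry1 subrr].
move=> [a0 a1] [b0 b1]; split=> i.
  by rewrite tdegM tdegV a0 b0 subrr.
rewrite tentryM tentryV; apply: lbound_ratio; first exact: tentry_neq0.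
have -> : ldeg (tentry b i) = 0 by exact: b0.
rewrite add0r -(subrKA 1) -[1 - _]opprB.
by apply: lboundB.
Qed.

Lemma torus_fil_decr m : torus_fil m.+1 `<=` torus_fil m.
Proof. by move=> u [u0 u1]; split=> // i; apply: lbound_le (u1 i); lia. Qed.

Lemma torus_fil_le m m' : (m <= m')%N -> torus_fil m' `<=` torus_fil m.
Proof.
move=> mm' u; rewrite -(subnKC mm'); elim: (m' - m)%N => [|j IHj]; first by rewrite addn0.
by rewrite addnS => /torus_fil_decr.
Qed.

Lemma torus_fil_basis (V : set torus) a : open V -> V a ->
  exists m, forall u, torus_fil m u -> V (a * u)%g.
Proof.
move=> [V1 [V2 oV2 <-] <-] aV.
have : nbhs (SL_mx (diagSL_SL a)) V2 by exact: open_nbhs_nbhs.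
move=> [P aP PV2].
have /choice[k kP] : forall i, exists k : nat,
    forall u, torus_fil k u -> P i i (tentry (a * u)%g i).
  move=> i; have /nbhs_ballP[e /= e0 eP] := aP i i.
  have [k kP] := @lnorm_small F e e0.
  exists (k + `|tdeg a i|)%N => u [u0 u1]; apply: eP.
  rewrite ballEmdist /=.
  suff : lnorm (tentry a i - tentry (a * u)%g i) < e by [].
  apply: kP; have -> : tentry a i - tentry (a * u)%g i =
      - (tentry a i * (tentry u i - 1)) by rewrite tentryM mulrBr mulr1 opprB.
  apply: lboundN; apply: lbound_le (lboundM (@ldeg_lbound _ _) (u1 i)).
  by rewrite -[ldeg _]/(tdeg a i); lia.
exists (\sum_i k i)%N => u uU; apply: PV2 => i j.
have [<-|ij] := eqVneq i j.
  by apply: kP; apply: torus_fil_le uU; rewrite (bigD1 i)//= leq_addr.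
by rewrite torus_offdiag//; have := nbhs_singleton (aP i j); rewrite torus_offdiag.
Qed.

Lemma torus_fil_nbhs a m : nbhs a [set (a * u)%g | u in torus_fil m].
Proof.
pose e i : rat := #|F|%:R ^ (tdeg a i - m.+1%:Z + 1).
pose P (i j : 'I_n) : set K := [set y | ldist (SL_mx (diagSL_SL a) i j) y < e i].
have e0 i : 0 < e i.
  by rewrite exprz_gt0// ltr0n; apply: leq_trans (finNzRing_gt1 F).
have aP : nbhs (SL_mx (diagSL_SL a)) [set M : 'M[K]_n | forall i j, P i j (M i j)].
  exists P => // i j; apply/nbhs_ballP; exists (e i); first exact: e0.
  by move=> y; rewrite ballEmdist.
have H : nbhs a [set b : torus | forall i j, P i j (SL_mx (diagSL_SL b) i j)].
  exact: (@initial_continuous _ _ (@diagSL_SL K n) a _ (@initial_continuous _ _ (@SL_mx K n) (diagSL_SL a) _ aP)).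
apply: filterS H => b /= bP; exists (a^-1 * b)%g; last by rewrite mulVKg.
have ab i : lbound (- m.+1%:Z) (tentry (a^-1 * b)%g i - 1).
  rewrite tentryM tentryV mulrC; apply: lbound_ratio; first exact: tentry_neq0.
  have bi : lnorm (tentry a i - tentry b i) < e i := bP i i.
  rewrite -[tentry b i - _]opprB; apply: lboundN; exact: lnorm_lt_lbound bi.
split=> i; first by apply: near1_ldeg (ab i); lia.
by apply: lbound_le (ab i); lia.
Qed.

(** The entries converge one by one, to nonzero limits because all degrees are
    constant along the sequence. The product of the limits is 1, since it is
    arbitrarily close to 1. *)
Lemma torus_fil_complete (x : nat -> torus) :
  (forall m, torus_fil m ((x m)^-1 * x m.+1)%g) ->
  exists y, forall m, torus_fil m ((x m)^-1 * y)%g.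
Proof.
move=> xU.
have tdegx m i : tdeg (x m) i = tdeg (x 0%N) i.
  elim: m => // m <-; have [/(_ i) + _] := xU m.
  by rewrite tdegM tdegV; lia.
have /choice[y yP] : forall i, exists y, forall m,
    lbound (tdeg (x 0%N) i - m%:Z) (y - tentry (x m) i).
  move=> i; apply: laurent_cauchy_lim => [m|m|z]; [|lia|]; last first.
    by exists `|(tdeg (x 0%N) i - z + 1)%R|%N; lia.
  have [_ /(_ i)] := xU m; rewrite tentryM tentryV => x1.
  have -> : tentry (x m.+1) i - tentry (x m) i =
      tentry (x m) i * ((tentry (x m) i)^-1 * tentry (x m.+1) i - 1).
    by rewrite mulrBr mulr1 mulVKf// tentry_neq0.
  rewrite -(tdegx m i); apply: lboundM => //; exact: ldeg_lbound.
have yx m i : lbound (- m%:Z) (y i / tentry (x m) i - 1).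
  apply: lbound_ratio; first exact: tentry_neq0.
  by rewrite -[ldeg _]/(tdeg (x m) i) tdegx.
have y1 : \prod_i y i = 1.
  apply/eqP; rewrite -subr_eq0; apply/eqP/laurentP => z.
  pose m := `|z|.+1.
  have -> : \prod_i y i = \prod_i (y i / tentry (x m) i).
    by rewrite big_split /= prodfV prod_tentry invr1 mulr1.
  have H : lbound (- m%:Z) (\prod_i (y i / tentry (x m) i) - 1).
    apply: (big_ind (fun f : K => lbound (- m%:Z) (f - 1))) => //.
      by rewrite subrr.
    by move=> f h; apply: near1_mul; lia.
  by rewrite H//; lia.
have [b bE] := mk_torus y1; exists b => m.
have bx i k : lbound (- k%:Z) (tentry ((x k)^-1 * b)%g i - 1).
  by rewrite tentryM tentryV mulrC bE; exact: yx.
split=> i; last exact: bx.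
have bdeg : tdeg b i = tdeg (x 1%N) i.
  have : tdeg ((x 1%N)^-1 * b)%g i = 0 by apply: near1_ldeg (bx i 1%N).
  by rewrite tdegM tdegV; lia.
by rewrite tdegM tdegV bdeg !tdegx; lia.
Qed.

(** Representatives of the finitely many classes modulo Lam and A_0 leave a
    factor u in A_0, whose class modulo the m-th congruence subgroup is given by
    the coefficients of its entries in degrees 0, ..., - m. *)
Lemma torus_fil_finite (g : SL K n) m : finite_index_mod_units g ->
  exists (I : finType) (phi : torus -> I), forall x y, phi x = phi y ->
    exists l u, [/\ diag_stab (coset_proj (@SL_poly F n) g) l, torus_fil m u &
      (y = x * l * u)%g].
Proof.
set Lam := diag_stab _ => -[I [phi phiP]].
have [LG1 LGV] := diag_stab_closed g.
pose r i : torus := xget 1%g [set a | phi a = i].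
have rP a : phi (r (phi a)) = phi a.
  by rewrite /r; apply: (@xgetPex _ _ [set b | phi b = phi a]); exists a.
have /choice[u uP] : forall a, exists u, torus_fil 0 u /\
    exists2 l, Lam l & (a = r (phi a) * l * u)%g.
  move=> a; have [l Ll la] := phiP a (r (phi a)) (esym (rP a)).
  exists ((r (phi a) * l)^-1 * a)%g; split; last by exists l => //; rewrite mulVKg.
  have u0 i : tdeg ((r (phi a) * l)^-1 * a)%g i = 0.
    by rewrite !tdegM tdegV tdegM la; lia.
  split=> // i; apply: lboundB; last exact: lbound_mono.
  by rewrite oppr0 -(u0 i); exact: ldeg_lbound.
exists (I * {ffun 'I_n * 'I_m.+1 -> F})%type.
exists (fun a => (phi a, [ffun ik : 'I_n * 'I_m.+1 => tentry (u a) ik.1 (- ik.2%:Z)])).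
move=> a b [pab /ffunP uab].
have [[ua0 ua1] [l Ll aE]] := uP a; have [[ub0 ub1] [l' Ll' bE]] := uP b.
exists (l^-1 * l')%g, ((u a)^-1 * u b)%g; split.
- rewrite torus_mulgC; have := LGV l' l; rewrite !inE; exact.
- have ab i : lbound (- m%:Z) (tentry ((u a)^-1 * u b)%g i - 1).
    rewrite tentryM tentryV mulrC; apply: lbound_ratio; first exact: tentry_neq0.
    rewrite -[ldeg _]/(tdeg (u a) i) ua0 add0r => z zm.
    have [z0|z0] := ltP 0 z.
      apply: (@lboundB _ 0) => //; [rewrite -(ub0 i)|rewrite -(ua0 i)]; exact: ldeg_lbound.
    have zlt : (`|z| < m.+1)%N by lia.
    have := uab (i, Ordinal zlt); rewrite !ffunE /=.
    have -> : - `|z|%N%:Z = z by lia.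
    by move=> ->; rewrite subrr.
  by split=> // i; rewrite tdegM tdegV ua0 ub0; lia.
- move: aE bE; rewrite -pab; move: (u a) (u b) (r _) => w w' z -> ->.
  exact/cancel_commuting/torus_mulgC.
Qed.

(** For u in the stabilizer, g^-1 (u - 1) g has polynomial entries; if u is
    closer to 1 than the entries of g and of its inverse are large, their
    degrees are negative, so they vanish. *)
Lemma torus_fil_stab (g : SL K n) : exists m, forall u,
  torus_fil m u -> diag_stab (coset_proj (@SL_poly F n) g) u -> u = 1%g.
Proof.
pose gV := invmx (SL_mx g).
have [C gC] : exists C : nat, forall i j,
    lbound C%:Z (SL_mx g i j) /\ lbound C%:Z (gV i j).
  exists (\sum_i \sum_j (`|ldeg (SL_mx g i j)| + `|ldeg (gV i j)|))%N => i j.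
  by split; apply: lbound_le (@ldeg_lbound _ _); rewrite (bigD1 i)//= (bigD1 j)//=; lia.
exists (C + C).+1 => u [u0 u1] /diag_stab_polyP[P uP].
have gu := SL_unit g.
have E : map_mx (@poly_laurent F) (P - 1%:M) =
    gV *m diag_mx (\row_i (tentry u i - 1)) *m SL_mx g.
  have -> : diag_mx (\row_i (tentry u i - 1)) = SL_mx (diagSL_SL u) - 1%:M.
    rewrite torus_mxE -diag_const_mx -raddfB; congr diag_mx.
    by apply/rowP => i; rewrite !mxE.
  rewrite mulmxBr mulmxBl -mulmxA uP mulKmx// mulmx1 mulVmx//.
  by rewrite map_mxB map_mx1.
have P1 : P = 1%:M.
  apply/eqP; rewrite -subr_eq0; apply/eqP/matrixP => i j; rewrite [RHS]mxE.
  apply: poly_laurent_lt0.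
  have := congr1 (fun M : 'M[K]_n => M i j) E; rewrite [LHS]mxE => ->.
  rewrite mxE; apply: lbound_sum => k _; rewrite mul_mx_diag !mxE.
  have -> : -1 = C%:Z + - (C + C).+1%:Z + C%:Z by lia.
  apply: lboundM; last by have [] := gC k j.
  by apply: lboundM => //; have [] := gC i k.
apply: torus_ext => i; rewrite tentry1 /tentry.
have : SL_mx (diagSL_SL u) = 1%:M.
  by move: uP; rewrite P1 map_mx1 mulmx1 => /(congr1 (mulmx^~ gV)); rewrite mulmxK// mulmxV.
by move=> ->; rewrite mxE eqxx.
Qed.

Lemma diag_stab_discrete (g : SL K n) :
  discrete_subgroup (diag_stab (coset_proj (@SL_poly F n) g)).
Proof.
have LG := diag_stab_closed g; split=> // l Ll.
set Lam := diag_stab _ in LG Ll *.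
have [m mP] := torus_fil_stab g; split; first by rewrite inE.
exists [set (l * u)%g | u in torus_fil m]; first exact: torus_fil_nbhs.
apply/seteqP; split=> [_ [[u Uu <-] Llu]|_ ->].
  have -> : u = 1%g; last by rewrite mulg1.
  apply: mP => //; have := LG.2 (l * u)%g l.
  by rewrite !inE => /(_ Llu Ll); rewrite (torus_mulgC l) mulgK.
split=> //; exists 1%g; last by rewrite mulg1.
by have := (torus_fil_group m).1; rewrite inE.
Qed.

Lemma torus_filtration (g : SL K n) : finite_index_mod_units g ->
  filtration (diag_stab (coset_proj (@SL_poly F n) g)).
Proof.
move=> gfin; apply: (@Filtration _ _ torus_fil).
- exact: torus_mulgC.
- exact: diag_stab_closed.
- exact: torus_fil_group.
- exact: torus_fil_decr.
- exact: torus_fil_basis.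
- exact: torus_fil_complete.
- by move=> m; exact: torus_fil_finite.
Qed.

End TorusTopology.

(** * Recurrence on a periodic orbit *)

Lemma cancel_common (G : groupType) (x y w : G) :
  (y^-1 * x * w = w * (y^-1 * x))%g -> ((y * w)^-1 * (x * w) = y^-1 * x)%g.
Proof. by move=> xyw; rewrite invgM -mulgA (mulgA y^-1%g) xyw mulKg. Qed.

Section Recurrence.
Variables (R : realType) (F : finFieldType) (n : nat) (g : SL (laurent F) n).
Local Notation torus := (diagSL (laurent F) n).
Local Notation Lam := (diag_stab (coset_proj (@SL_poly F n) g)).

Let stab_coset_projP := coset_projP (diag_stab_closed g).

(** The orbits of A_0 in A / Lam. *)
Definition compact_orbit (a : torus) : set (coset_space Lam) :=
  [set coset_proj Lam (a * u)%g | u in torus_fil 0].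

Lemma compact_orbit_open a : open (compact_orbit a).
Proof.
suff : open (coset_proj Lam @^-1` compact_orbit a) by [].
rewrite openE => x [u Uu /stab_coset_projP Lxu].
apply: filterS (torus_fil_nbhs x 0) => _ [w Uw <-].
exists (u * w)%g; first exact: (group_closedM (@torus_fil_group F n 0) Uu Uw).
apply/stab_coset_projP.
by rewrite (mulgA a) cancel_common//; exact: torus_mulgC.
Qed.

Lemma compact_orbit_act a : coset_act a @` compact_orbit 1%g = compact_orbit a.
Proof.
apply/seteqP; split=> c.
  by move=> [_ [u Uu <-] <-]; exists u => //; rewrite coset_proj_act mul1g.
by move=> [u Uu <-]; exists (coset_proj Lam (1 * u)%g); [exists u|rewrite coset_proj_act mul1g].
Qed.

Lemma compact_orbit_deg a b c : compact_orbit a c -> compact_orbit b c ->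
  exists2 l, Lam l & forall i, tdeg l i = tdeg b i - tdeg a i.
Proof.
move=> [u [Uu _] <-] [w [Uw _]] /esym/stab_coset_projP Ll.
exists ((a * u)^-1 * (b * w))%g => // i.
by rewrite tdegM tdegV !tdegM Uu Uw; lia.
Qed.

(** Poincare recurrence. The orbits compact_orbit a all have the same measure v,
    and v > 0 because countably many of them, one for each degree vector, cover
    the quotient. Elements E k of degree vector k d cannot all have disjoint
    orbits in a space of finite measure, and E j, E k sharing an orbit means that
    (k - j) d is the degree vector of an element of the stabilizer. *)
Lemma periodic_recurrence (d : 'I_n -> int) :
  periodic_orbit R (coset_proj (@SL_poly F n) g) -> \sum_i d i = 0 ->
  exists (k : nat) (l : torus),
    [/\ (0 < k)%N, Lam l & forall i, tdeg l i = k%:Z * d i].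
Proof.
move=> [_ [mu [/andP[mu0 muoo] mu_act]]] d0.
have mY a : (@open (coset_space Lam)).-sigma.-measurable (compact_orbit a).
  by apply: sub_sigma_algebra; exact: compact_orbit_open.
pose v := mu (compact_orbit 1%g).
have muY a : mu (compact_orbit a) = v.
  by rewrite -compact_orbit_act; exact: mu_act (mY _).
have v0 : (0 < v)%E.
  rewrite lt0e measure_ge0 andbT; apply/negP => /eqP v0.
  have /choice[t tP] : forall k : nat, exists a : torus, forall d' : {ffun 'I_n -> int},
      unpickle k = Some d' -> \sum_i d' i = 0 -> tdeg a =1 d'.
    move=> k; case: unpickle => [d'|]; last by exists 1%g.
    have [d'0|nd'] := pselect (\sum_i d' i = 0); last by exists 1%g => _ [<-].
    by have [a aE] := mk_torus_deg F d'0; exists a => _ [<-].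
  have cover : setT `<=` \bigcup_k compact_orbit (t k).
    move=> c _; have [a <-] := coset_proj_surj c.
    pose d' : {ffun 'I_n -> int} := [ffun i => tdeg a i].
    have d'0 : \sum_i d' i = 0.
      by under eq_bigr do rewrite ffunE; exact: sum_tdeg.
    have ta := tP (pickle d') d' (pickleK d') d'0.
    exists (pickle d') => //; exists ((t (pickle d'))^-1 * a)%g.
      have u0 i : tdeg ((t (pickle d'))^-1 * a)%g i = 0.
        by rewrite tdegM tdegV ta ffunE; lia.
      split=> // i; apply: lboundB; last exact: lbound_mono.
      by rewrite oppr0 -(u0 i); exact: ldeg_lbound.
    by rewrite mulVKg.
  have := measure_sigma_subadditive mu (fun k => mY (t k)) measurableT cover.
  rewrite leNgt => /negP; apply.
  by rewrite eseries0// => k _ _; rewrite muY.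
apply: contrapT => nk.
have /choice[E EP] : forall k : nat, exists a : torus, tdeg a =1 (fun i => k%:Z * d i).
  by move=> k; apply: mk_torus_deg; rewrite -mulr_sumr d0 mulr0.
have Elt j k c : (j < k)%N -> compact_orbit (E j) c -> compact_orbit (E k) c -> False.
  move=> jk jc kc; have [l Ll lE] := compact_orbit_deg jc kc.
  apply: nk; exists (k - j)%N, l; split=> // [|i]; first by rewrite subn_gt0.
  by rewrite lE !EP -mulrBl; congr (_ * _); lia.
have triv : trivIset setT (fun k => compact_orbit (E k)).
  move=> j k _ _ [c [jc kc]]; have [jk|kj|//] := ltngtP j k; exfalso.
    exact: (Elt j k c jk jc kc).
  exact: (Elt k j c kj kc jc).
have vT : (v <= mu setT)%E.
  by apply: le_measure; rewrite ?inE//; exact: mY.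
have vfin : v \is a fin_num.
  by rewrite ge0_fin_numE ?measure_ge0//; exact: le_lt_trans vT muoo.
have mfin : mu setT \is a fin_num by rewrite ge0_fin_numE ?measure_ge0.
have bound N : (v *+ N <= mu setT)%E.
  apply: (@le_trans _ _ (mu (\bigcup_k compact_orbit (E k)))); last first.
    apply: le_measure; rewrite ?inE//.
    by apply: bigcup_measurable => k _; exact: mY.
  rewrite measure_bigcup//=; last by move=> k _; exact: mY.
  apply: le_trans (nneseries_lim_ge N _); last by move=> *; exact: measure_ge0.
  rewrite (eq_bigl xpredT); last by move=> i; rewrite in_setT.
  by rewrite (eq_bigr (fun=> v))// sumr_const_nat subn0.
pose x := fine v; pose M := fine (mu setT).
have x0 : 0 < x by apply: fine_gt0; rewrite v0 ltey_eq vfin.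
have := bound (Num.bound (M / x)).
rewrite -(fineK vfin) -(fineK mfin) -/x -/M -EFin_natmul lee_fin leNgt => /negP; apply.
rewrite -mulr_natl -ltr_pdivrMr//; apply: archi_boundP.
by rewrite divr_ge0 ?(ltW x0)//; exact: fine_ge0.
Qed.

End Recurrence.

(** * The field generated by an eigenvalue of a unit *)

Section AdjoinMorphism.
Variables (F0 : fieldType) (L : fieldExtType F0) (K : fieldType).
Variable iota : {rmorphism F0 -> K}.
Variables (p : {poly F0}) (z : L) (a : K).
Hypotheses (p_irr : irreducible_poly p) (zL : <<1; z>>%VS = fullv).
Hypothesis pz : root (map_poly (in_alg L) p) z.
Hypothesis pa : root (map_poly iota p) a.

Lemma adjoin_repr (x : L) : exists q, x = (map_poly (in_alg L) q).[z].
Proof.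
have xz : x \in <<1%AS; z>>%VS by rewrite zL memvf.
have /polyOver1P[q qE] := Fadjoin_polyOver 1 z x.
by exists q; rewrite -qE (Fadjoin_poly_eq xz).
Qed.

Lemma irreducible_dvdp_root q : root (map_poly (in_alg L) q) z -> p %| q.
Proof.
move=> qz; have gz : root (map_poly (in_alg L) (gcdp p q)) z.
  by rewrite gcdp_map root_gcd pz.
have /(p_irr.2 _)/(_ (dvdp_gcdl _ _)) : size (gcdp p q) != 1%N.
  apply: contraL gz => /size_poly1P[c c0 ->].
  by rewrite map_polyC rootC fmorph_eq0.
by rewrite /eqp => /andP[_ /dvdp_trans]; apply; exact: dvdp_gcdr.
Qed.

(** A morphism on L = F0(z) is evaluation at a of the polynomials in z; it is well
    defined because a polynomial vanishing at z is a multiple of p. *)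
Lemma adjoin_morphism : exists s : {rmorphism L -> K},
  (forall r, s r%:A = iota r) /\ s z = a.
Proof.
have [Q QE] := choice adjoin_repr.
pose s x := (map_poly iota (Q x)).[a].
have sE q x : x = (map_poly (in_alg L) q).[z] -> s x = (map_poly iota q).[a].
  move=> xq; apply/eqP; rewrite -subr_eq0 -hornerN -hornerD -rmorphB.
  have /dvdpP[r ->] : p %| Q x - q.
    apply: irreducible_dvdp_root; rewrite /root rmorphB hornerD hornerN.
    by rewrite -QE -xq subrr.
  by rewrite rmorphM hornerM (eqP pa) mulr0.
have s_add : zmod_morphism s.
  move=> x y; rewrite (sE (Q x - Q y)); first by rewrite rmorphB hornerD hornerN.
  by rewrite rmorphB hornerD hornerN -!QE.
have s_mul : monoid_morphism s.
  split=> [|x y].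
    by rewrite (sE 1) rmorph1 hornerC.
  rewrite (sE (Q x * Q y)); first by rewrite rmorphM hornerM.
  by rewrite rmorphM hornerM -!QE.
pose sA := GRing.isZmodMorphism.Build L K s s_add.
pose sM := GRing.isMonoidMorphism.Build L K s s_mul.
pose sR : {rmorphism L -> K} := HB.pack s sA sM.
exists sR; split=> [r|].
  by rewrite [LHS](sE r%:P) map_polyC hornerC.
by rewrite [LHS](sE 'X) map_polyX hornerX.
Qed.

Lemma adjoin_morphism_unique (s1 s2 : {rmorphism L -> K}) :
  (forall r, s1 r%:A = s2 r%:A) -> s1 z = s2 z -> s1 =1 s2.
Proof.
move=> s12 sz x; have [q ->] := adjoin_repr x.
rewrite -!horner_map sz; congr (_.[_]); apply/polyP => i.
by rewrite !coef_map; exact: s12.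
Qed.

End AdjoinMorphism.

Lemma monic_scale_lead (K : fieldType) (q : {poly K}) :
  q != 0 -> (lead_coef q)^-1 *: q \is monic.
Proof. by move=> q0; rewrite monicE lead_coefZ mulVf// lead_coef_eq0. Qed.

Section IntegrallyClosed.
Variable F : finFieldType.
Local Notation K := (laurent F).
Local Notation pl := (@poly_laurent F).
Local Notation fl := (@fraction_laurent F).
Local Notation tofrac := (@FracField.tofrac {poly F}).

Lemma fraction_coprime (x : {fraction {poly F}}) : exists p q : {poly F},
  [/\ q != 0, coprimep p q & x = tofrac p / tofrac q].
Proof.
have [p [q [q0 ->]]] := fractionP x.
pose d := gcdp p q.
have d0 : d != 0 by rewrite gcdp_eq0 (negPf q0) andbF.
have qd : q = q %/ d * d by rewrite divpK// dvdp_gcdr.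
have pd : p = p %/ d * d by rewrite divpK// dvdp_gcdl.
have q'0 : q %/ d != 0 by apply: contraNneq q0 => q'0; rewrite qd q'0 mul0r.
exists (p %/ d), (q %/ d); split=> //; first by rewrite coprimep_div_gcd// q0 orbT.
rewrite {1}pd {1}qd !rmorphM invfM mulrACA mulfV ?tofrac_eq0// mulr1.
by [].
Qed.

(** F[t] is integrally closed: clearing denominators in the equation of x = p / q
    shows that q divides a power of p, while p and q are coprime. *)
Lemma integral_fraction (x : {fraction {poly F}}) :
  integralOver pl (fl x) -> exists u, x = tofrac u.
Proof.
move=> [P Pmon Px].
have {}Px : root (map_poly tofrac P) x.
  rewrite -(fmorph_root fl) -map_poly_comp.
  rewrite (eq_map_poly (g := pl))// => q /=; exact: fraction_laurent_tofrac.
have [p [q [q0 pq xE]]] := fraction_coprime x.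
pose m := (size P).-1.
have Pm : P`_m = 1 by move: Pmon; rewrite monicE => /eqP.
have sP : size P = m.+1 by rewrite prednK// size_poly_gt0 monic_neq0.
have E : \sum_(i < m.+1) P`_i * (p ^+ i * q ^+ (m - i)) = 0.
  apply/eqP; rewrite -(tofrac_eq0) rmorph_sum /=.
  have tq0 : tofrac q != 0 by rewrite tofrac_eq0.
  have H : tofrac q ^+ m * (map_poly tofrac P).[x] = 0 by rewrite (eqP Px) mulr0.
  have szP : (size (map_poly tofrac P) <= m.+1)%N by rewrite -sP; exact: size_poly.
  apply/eqP; apply: etrans H.
  rewrite (horner_coef_wide x szP) mulr_sumr; apply: eq_bigr => i _.
  have im : (i <= m)%N by rewrite -ltnS.
  rewrite coef_map /= !rmorphM !rmorphXn /= xE expr_div_n.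
  have -> : tofrac q ^+ m = tofrac q ^+ (m - i) * tofrac q ^+ i.
    by rewrite -exprD subnK.
  rewrite [RHS]mulrCA; congr (_ * _).
  by rewrite mulrAC -mulrA divfK ?expf_neq0// mulrC.
have qpm : q %| p ^+ m.
  move: E; rewrite big_ord_recr /= Pm mul1r subnn expr0 mulr1 => /eqP.
  rewrite addrC addr_eq0 => /eqP ->; rewrite dvdpNr.
  apply: (big_ind (fun r => q %| r)) => [|r1 r2|i _]; first exact: dvdp0.
    exact: dvdp_add.
  have -> : (m - i = (m - i).-1.+1)%N by rewrite prednK// subn_gt0.
  by rewrite exprSr !mulrA dvdp_mull.
have : size q == 1%N.
  by rewrite -coprimepp; apply: coprimep_dvdl qpm _; apply: coprimep_expr; rewrite coprimep_sym.
move=> /size_poly1P[c c0 qc].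
exists (c^-1 *: p); rewrite xE qc; apply: (canLR (mulfK _)).
  by rewrite tofrac_eq0 polyC_eq0.
by rewrite -rmorphM -scalerAl mulrC mul_polyC scalerA mulVf// scale1r.
Qed.

End IntegrallyClosed.

Section UnitToField.
Variables (F : finFieldType) (n : nat).
Local Notation K := (laurent F).
Local Notation pl := (@poly_laurent F).
Local Notation fl := (@fraction_laurent F).
Local Notation tofrac := (@FracField.tofrac {poly F}).

Variables (l : diagSL K n) (g : SL K n) (P : 'M[{poly F}]_n).
Hypothesis lg : SL_mx (diagSL_SL l) *m SL_mx g = SL_mx g *m map_mx pl P.
Hypothesis tdeg_inj : injective (tdeg l).
Hypothesis tdeg_sum : forall I : {set 'I_n},
  \sum_(i in I) tdeg l i = 0 -> I = finset.set0 \/ I = finset.setT.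
Hypothesis n0 : (0 < n)%N.

Let a i := tentry l i.
Let chi := char_poly P.
Let p := map_poly tofrac chi.

Lemma tentry_inj : injective (tentry l).
Proof. by move=> i j ij; apply: tdeg_inj; rewrite /tdeg ij. Qed.

Lemma map_chi : map_poly pl chi = \prod_i ('X - (a i)%:P).
Proof.
rewrite map_char_poly.
have E : map_mx polyC (SL_mx g) *m char_poly_mx (map_mx pl P) =
    char_poly_mx (SL_mx (diagSL_SL l)) *m map_mx polyC (SL_mx g).
  rewrite mulmxBl mulmxBr -!map_mxM lg; congr (_ - _).
  by rewrite mul_mx_scalar mul_scalar_mx.
have := congr1 determinant E; rewrite !det_mulmx det_map_mx det_SL.
rewrite rmorph1 mul1r mulr1 /char_poly => ->.
rewrite -[LHS]/(char_poly (SL_mx (diagSL_SL l))) char_poly_trig//.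
by apply: is_diag_mx_is_trig; exact: valP l.
Qed.

Lemma map_p : map_poly fl p = \prod_i ('X - (a i)%:P).
Proof.
rewrite -map_chi /p -map_poly_comp.
by apply: eq_map_poly => q /=; exact: fraction_laurent_tofrac.
Qed.

Lemma size_p : size p = n.+1.
Proof.
rewrite -(size_map_poly fl) map_p size_prod_XsubC.
by rewrite -[RHS]/(n.+1) /index_enum -enumT size_enum_ord.
Qed.

Lemma integral_tentry i : integralOver pl (a i).
Proof.
exists chi; first exact: char_poly_monic.
rewrite map_chi /root horner_prod (bigD1 i)//= hornerXsubC subrr mul0r.
by [].
Qed.

Lemma integral_prod (I : Type) (r : seq I) (Q : pred I) (E : I -> K) :
  (forall i, integralOver pl (E i)) -> integralOver pl (\prod_(i <- r | Q i) E i).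
Proof.
move=> Ei; apply: (big_ind (integralOver pl)) => //; first exact: integral1.
by move=> x y; exact: integral_mul.
Qed.

Lemma integral_tentryV i : integralOver pl (a i)^-1.
Proof.
have -> : (a i)^-1 = \prod_(j | j != i) a j.
  apply: (mulfI (tentry_neq0 l i)); rewrite mulfV ?tentry_neq0//.
  by apply: etrans (esym (prod_tentry l)) _; rewrite [LHS](bigD1 i).
by apply: integral_prod; exact: integral_tentry.
Qed.

(** Such a product is integral over F[t], and so is its inverse because the
    product of all the a i is 1. If it lies in F(t), it is a unit of F[t], a
    nonzero constant, and its degree is 0. *)
Lemma fraction_prod_tentry (I : {set 'I_n}) (x : {fraction {poly F}}) :
  fl x = \prod_(i in I) - a i -> I = finset.set0 \/ I = finset.setT.
Proof.
move=> xI; apply: tdeg_sum.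
have [u xu] : exists u, x = tofrac u.
  apply: integral_fraction; rewrite xI; apply: integral_prod => i.
  by apply: integral_opp; exact: integral_tentry.
have [w xw] : exists u, x^-1 = tofrac u.
  apply: integral_fraction; rewrite fmorphV /= xI -prodfV; apply: integral_prod => i.
  by rewrite invrN; apply: integral_opp; exact: integral_tentryV.
have x0 : x != 0.
  rewrite -(fmorph_eq0 fl) /= xI; apply/prodf_neq0 => i _.
  by rewrite oppr_eq0 tentry_neq0.
have uw : u * w = 1.
  by apply/eqP; rewrite -tofrac_eq rmorphM /= -xu -xw mulfV// rmorph1.
have /andP[su _] : (size u == 1%N) && (u`_0 \is a GRing.unit).
  by rewrite -poly_unitE; apply/unitrPr; exists w.
have u0 : u != 0 by rewrite -size_poly_gt0 (eqP su).
have := ldeg_poly u0; rewrite (eqP su) -fraction_laurent_tofrac -xu xI.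
rewrite ldeg_prod; last by move=> i _; rewrite oppr_eq0 tentry_neq0.
by under eq_bigr do rewrite ldegN.
Qed.

(** The monic associate q' of a factor is a product of some of the X - a i, so
    that fraction_prod_tentry applies to its constant term. *)
Lemma p_irreducible : irreducible_poly p.
Proof.
have pmon : p \is monic by apply: monic_map; exact: char_poly_monic.
have sp := size_p.
split=> [|q q1 qp]; first by rewrite sp.
have q0 : q != 0 by apply: contraTneq qp => ->; rewrite dvd0p monic_neq0.
have [m qm] : {m : bitseq | map_poly fl q %=
    \prod_(i <- mask m (index_enum 'I_n)) ('X - (a i)%:P)}.
  by apply: dvdp_prod_XsubC; rewrite -map_p dvdp_map.
set r := mask m _ in qm.
pose I := [set i in r]%SET.
have rI : \prod_(i <- r) ('X - (a i)%:P) = \prod_(i in I) ('X - (a i)%:P).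
  rewrite big_uniq/=; last by rewrite mask_uniq// index_enum_uniq.
  by apply: eq_bigl => i; rewrite inE.
pose q' := (lead_coef q)^-1 *: q.
have q'q : q' %= q by rewrite eqp_scale// invr_eq0 lead_coef_eq0.
have q'mon : q' \is monic by exact: monic_scale_lead.
have q'I : map_poly fl q' = \prod_(i in I) ('X - (a i)%:P).
  apply/eqP; rewrite -eqp_monic ?map_monic//; last exact: monic_prod_XsubC.
  by rewrite -rI (eqp_trans _ qm)// eqp_map.
have q'0I : fl q'.[0] = \prod_(i in I) - a i.
  rewrite -horner_map rmorph0 q'I horner_prod; apply: eq_bigr => i _.
  by rewrite hornerXsubC sub0r.
case: (fraction_prod_tentry q'0I) => IE.
  case/negP: q1; rewrite -(eqp_size q'q) -(size_map_poly fl) q'I IE.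
  by rewrite big_set0 size_poly1.
rewrite -(eqp_ltrans q'q); suff -> : q' = p by exact: eqpxx.
apply: (map_poly_inj fl); rewrite map_p q'I IE.
by apply: eq_bigl => i; rewrite finset.in_setT.
Qed.

(** The basis consists of the entries of a left eigenvector w of P over k. Under
    the i-th embedding w becomes a left eigenvector of P for a i; the rows of g
    form an eigenbasis for the distinct eigenvalues, so it is nu i times row i
    of g. Independence of the basis is then the invertibility of g. *)
Lemma unit_to_split_field :
  exists (k : fieldExtType {fraction {poly F}}) (alpha : n.-tuple k)
      (s : 'I_n -> {rmorphism k -> laurent F}),
    [/\ \dim {:k} = n,
        split_at_infty k n,
        basis_of {:k} alpha,
        all_embeddings s &
        proportional (linear_form_prod g)
          (linear_form_prod (\matrix_(i, j) s i (tnth alpha j)))].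
Proof.
have sp := size_p.
have [k dimk [z pz zk]] := irredp_FAdjoin p_irreducible.
have pa i : root (map_poly fl p) (a i).
  by rewrite map_p /root horner_prod (bigD1 i)//= hornerXsubC subrr mul0r.
have /choice[s sP] := fun i => adjoin_morphism (iota := fl) p_irreducible zk pz (pa i).
have /eigenvalueP[w wP w0] : eigenvalue (map_mx (in_alg k \o tofrac) P) z.
  rewrite eigenvalue_root_char -map_char_poly.
  by move: pz; rewrite /p -map_poly_comp.
pose alpha : n.-tuple k := [tuple w 0 j | j < n].
have alphaE j : tnth alpha j = w 0 j by rewrite tnth_mktuple.
have sfl i q : s i (tofrac q)%:A = pl q.
  by rewrite (sP i).1; exact: fraction_laurent_tofrac.
have swP i : map_mx (s i) w *m map_mx pl P = a i *: map_mx (s i) w.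
  rewrite -(sP i).2 -map_mxZ -wP map_mxM; congr (_ *m _).
  by apply/matrixP => x y; rewrite !mxE; symmetry; exact: sfl.
pose nu i := (map_mx (s i) w *m invmx (SL_mx g)) 0 i.
have swE i : map_mx (s i) w = nu i *: row i (SL_mx g).
  have gu := SL_unit g.
  pose y := map_mx (s i) w *m invmx (SL_mx g).
  have yg : map_mx (s i) w = y *m SL_mx g by rewrite mulmxKV.
  have yl : y *m SL_mx (diagSL_SL l) = a i *: y.
    have := swP i; rewrite {1}yg -mulmxA -lg mulmxA yg scalemxAl.
    by move=> /(congr1 (mulmx^~ (invmx (SL_mx g)))); rewrite !mulmxK.
  have y0 j : j != i -> y 0 j = 0.
    move=> ji; have := yl; rewrite torus_mxE mul_mx_diag => /rowP/(_ j).
    rewrite !mxE mulrC => /eqP; rewrite -subr_eq0 -mulrBl mulf_eq0 subr_eq0.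
    by case/orP => /eqP // /tentry_inj ji'; rewrite ji' eqxx in ji.
  rewrite yg; apply/rowP => j; rewrite !mxE (bigD1 i)//= big1 ?addr0//.
  by move=> j' j'i; rewrite y0// mul0r.
have nu0 i : nu i != 0.
  apply: contraNneq w0 => nui; have := swE i; rewrite nui scale0r => /eqP.
  by rewrite map_mx_eq0.
have free_alpha : free alpha.
  apply/freeP => c c0 j.
  suff E : (\row_j fl (c j)) *m (SL_mx g)^T = 0.
    have := congr1 (mulmx^~ (invmx (SL_mx g)^T)) E.
    rewrite mulmxK ?unitmx_tr ?SL_unit// mul0mx => /rowP/(_ j).
    by rewrite !mxE => /eqP; rewrite fmorph_eq0 => /eqP.
  apply/rowP => i; apply: (mulfI (nu0 i)); rewrite !mxE mulr0 -[RHS](rmorph0 (s i)).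
  rewrite -c0 rmorph_sum mulr_sumr; apply: eq_bigr => m _.
  rewrite -tnth_nth alphaE !mxE -mulr_algl rmorphM (sP i).1.
  have /rowP/(_ m) := swE i; rewrite !mxE => ->.
  by rewrite mulrCA.
have dimkn : \dim {:k} = n by rewrite dimk sp.
exists k, alpha, s; split=> //.
- exists z; split=> //.
  exists p, [seq a i | i <- enum 'I_n]; split.
  + apply/eqP; rewrite -eqp_monic ?monic_minPoly ?map_monic//; last first.
      by apply: monic_map; exact: char_poly_monic.
    rewrite eqp_sym -dvdp_size_eqp; last first.
      by apply: minPoly_dvdp => //; apply/polyOver1P; exists p.
    rewrite size_minPoly size_map_poly sp eqSS.
    by have := dim_Fadjoin 1%AS z; rewrite dimv1 muln1 zk dimkn => <-.
  + by rewrite size_map size_enum_ord.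
  + by rewrite map_inj_uniq ?enum_uniq//; exact: tentry_inj.
  + by apply/allP => _ /mapP[i _ ->].
- by rewrite basisEfree free_alpha subvf size_tuple dimkn leqnn.
- split=> [i|i j ij|s' s'e].
  + exact: (sP i).1.
  + by apply: tentry_inj; have := ij z; rewrite !(sP _).2.
  + have : root (map_poly fl p) (s' z).
      rewrite -(eq_map_poly (f := s' \o in_alg k)); last by move=> r; exact: s'e.
      by rewrite map_poly_comp fmorph_root.
    rewrite map_p /root horner_prod prodf_seq_eq0 => /hasP[i _].
    rewrite /= hornerXsubC subr_eq0 => /eqP s'z; exists i.
    apply: (adjoin_morphism_unique zk); last by rewrite s'z (sP i).2.
    by move=> r; rewrite s'e (sP i).1.
exists (\prod_i (nu i)^-1).
  by apply/prodf_neq0 => i _; rewrite invr_eq0.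
move=> x; rewrite /linear_form_prod -big_split /=; apply: eq_bigr => i _.
apply: (mulfI (nu0 i)); rewrite mulrA mulfV// mul1r mulr_sumr.
apply: eq_bigr => j _; rewrite mxE alphaE mulrA.
by have /rowP/(_ j) := swE i; rewrite !mxE => ->.
Qed.

End UnitToField.

(** * The equivalence *)

(** Positive distinct entries, balanced by a single negative one. A subset of
    sum zero avoiding the negative entry is empty, and otherwise its complement
    is such a subset. *)
Lemma generic_degrees (n : nat) : (2 <= n)%N -> exists d : 'I_n -> int,
  [/\ \sum_i d i = 0, injective d &
   forall I : {set 'I_n}, \sum_(i in I) d i = 0 ->
     I = finset.set0 \/ I = finset.setT].
Proof.
case: n => // n n2.
pose o : 'I_n.+1 := ord_max.
pose s := \sum_(i | i != o) i.+1%:Z.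
pose d i := if i == o then - s else i.+1%:Z.
have s0 : 0 <= s by apply: sumr_ge0.
have dE i : i != o -> d i = i.+1%:Z by rewrite /d => /negPf->.
have sumd : \sum_i d i = 0.
  by rewrite (bigD1 o)//= (eq_bigr (fun i : 'I_n.+1 => i.+1%:Z))// {1}/d eqxx addNr.
exists d; split=> // [i j|].
  rewrite /d; case: eqP => [->|_]; case: eqP => [->|_] //.
  - by move=> H; exfalso; lia.
  - by move=> H; exfalso; lia.
  - by move=> [ij]; exact: val_inj.
have key (I : {set 'I_n.+1}) : o \notin I -> \sum_(i in I) d i = 0 -> I = finset.set0.
  move=> oI I0; apply/setP => j; rewrite finset.in_set0; apply/negP => jI.
  have E i : i \in I -> d i = i.+1%:Z.
    by move=> iI; apply: dE; apply: contraNneq oI => <-.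
  move: I0; rewrite (bigD1 j)//= (E j)//.
  have : 0 <= \sum_(i in I | i != j) d i by apply: sumr_ge0 => i /andP[/E -> _].
  by move=> H1 H2; move: H1 H2; set y := \sum_(i in I | _) _; lia.
move=> I I0; have [oI|] := boolP (o \in I); last by left; exact: key.
right; apply: finset.setC_inj; rewrite finset.setCT; apply: key.
  by rewrite finset.in_setC oI.
move: sumd; rewrite (bigID (mem I)) /= I0 add0r => H.
by rewrite -[RHS]H; apply: eq_bigl => i; rewrite finset.in_setC.
Qed.

Theorem theorem1p6 (R : realType) (F : finFieldType) (n : nat) (hn : (2 <= n)%N)
    (g : SL (laurent F) n) :
  (exists (k : fieldExtType {fraction {poly F}}) (alpha : n.-tuple k)
      (s : 'I_n -> {rmorphism k -> laurent F}),
    [/\ \dim {:k} = n,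
        split_at_infty k n,
        basis_of {:k} alpha,
        all_embeddings s &
        proportional (linear_form_prod g)
          (linear_form_prod (\matrix_(i, j) s i (tnth alpha j)))])
  <->
  periodic_orbit R (coset_proj (@SL_poly F n) g).
Proof.
have n0 : (0 < n)%N by exact: ltnW.
split=> [[k [alpha [s [_ _ alphaB sE Lg]]]]|orb].
  have gfin := split_field_units n0 alphaB sE Lg.
  split; first exact: diag_stab_discrete.
  exact: (filtration_invariant_measure R (torus_filtration gfin)).
have [d [d0 d_inj d_sum]] := generic_degrees hn.
have [k [l [k0 /diag_stab_polyP[P lP] lE]]] := periodic_recurrence orb d0.
have k0' : k%:Z != 0 by rewrite eqz_nat -lt0n.
apply: (unit_to_split_field lP) => [i j|I|//].
  by rewrite !lE => /(mulfI k0')/d_inj.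
under eq_bigr do rewrite lE.
by rewrite -mulr_sumr => /eqP; rewrite mulf_eq0 (negPf k0') => /eqP/d_sum.
Qed.
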